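(* Let $\Lambda=(V,E)$ be a complete special graph with $|V|=n+1$ vertices and $|E_s|=r$ special edges, and let $G_\Lambda$ be the associated oriented right-angled Artin group. Then there is an isomorphism of graded rings $$H^\bullet(G_\Lambda,\mathbb F_2)\;\cong\;\frac{\mathbb F_2[R,V_1,\dots,V_r]}{(R^2,\;V_i^2+RV_i:\ 1\le i\le r)}\otimes_{\mathbb F_2}\frac{\mathbb F_2[W_1,\dots,W_{n-r}]}{(W_j^2:\ 1\le j\le n-r)},$$ where all generators $R,V_i,W_j$ have degree $1$.
   Context: Special graphs. An oriented graph is a pair $\Gamma=(V,E)$ with $V$ a finite nonempty set and $E\subseteq (V\times V)\setminus\{(v,v): v\in V\}$; for $e=(v,w)\in E$ put $o(e)=v$, $t(e)=w$. Its underlying naive graph $\ddot\Gamma=(V,\ddot E)$ has $\{v,w\}\in\ddot E$ iff $(v,w)\in E$ or $(w,v)\in E$. A clique is a set of vertices pairwise adjacent in $\ddot\Gamma$. $\Gamma$ is special if there are decompositions (disjoint unions) $V=V_0\cup V_s$ and $E=E_0\cup E_s$ into normal (index $0$) and special (index $s$) vertices and edges such that: $(v,w)\in E_0$ implies $(w,v)\in E_0$ (a normal edge is a pair of mutually inverse arcs, counted as one edge); $(v,w)\in E_s$ implies $(w,v)\notin E$; a vertex is special iff it is the terminal vertex of a special edge; every clique contains at most one special vertex. $\Gamma$ is complete if any two distinct vertices are adjacent in $\ddot\Gamma$. Oriented RAAG. $G_\Gamma=\langle V\mid R(e): e\in E\rangle$, where $R(e)=t(e)o(e)t(e)^{-1}o(e)^{-1}$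 if $e\in E_0$ and $R(e)=t(e)o(e)t(e)^{-1}o(e)$ if $e\in E_s$. $H^\bullet(G,\mathbb F_2)$ denotes the cohomology ring of the group $G$ with trivial coefficients in the field $\mathbb F_2$ with two elements. *)

(* Defs.v *)
From HB Require Import structures.
From mathcomp Require Import all_boot all_algebra.
From mathcomp Require Import boolp.
From mathcomp Require Import ring.
From mathcomp Require Import mpoly.

Set Implicit Arguments.
Unset Strict Implicit.
Unset Printing Implicit Defensive.

Import GRing.Theory.
Local Open Scope ring_scope.
Local Open Scope quotient_scope.

Record orientedGraph := OrientedGraph {
  vertex : finType;
  arcs : {set vertex * vertex};
  vertex_nonempty : (0 < #|vertex|)%N;
  arcs_irreflexive : forall v, (v, v) \notin arcs
}.

Section OrientedGraph.
Variable g : orientedGraph.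
Implicit Types (v w : vertex g) (C : {set vertex g}).

Definition adjacent v w := ((v, w) \in arcs g) || ((w, v) \in arcs g).

Definition clique C := {in C &, forall v w, v != w -> adjacent v w}.

Definition complete := forall v w, v != w -> adjacent v w.

End OrientedGraph.

Record specialGraph := SpecialGraph {
  underlying :> orientedGraph;
  normal_vertices : {set vertex underlying};
  special_vertices : {set vertex underlying};
  normal_edges : {set vertex underlying * vertex underlying};
  special_edges : {set vertex underlying * vertex underlying};
  vertices_cover : normal_vertices :|: special_vertices = [set: vertex underlying];
  vertices_disjoint : [disjoint normal_vertices & special_vertices];
  edges_cover : normal_edges :|: special_edges = arcs underlying;
  edges_disjoint : [disjoint normal_edges & special_edges];
  normal_edge_sym : forall v w,
    (v, w) \in normal_edges -> (w, v) \in normal_edges;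
  special_edge_asym : forall v w,
    (v, w) \in special_edges -> (w, v) \notin arcs underlying;
  special_vertexP : forall w,
    reflect (exists v, (v, w) \in special_edges) (w \in special_vertices);
  clique_special : forall C : {set vertex underlying},
    clique C -> (#|C :&: special_vertices| <= 1)%N
}.

(* The letter (v, false) stands for v and (v, true) for its inverse. *)
Notation word X := (seq (X * bool)).

Section Presentation.
Variables (X : choiceType) (relator : word X -> Prop).

Inductive word_eq : word X -> word X -> Prop :=
| word_eq_refl u : word_eq u u
| word_eq_sym u v : word_eq u v -> word_eq v u
| word_eq_trans u v w : word_eq u v -> word_eq v w -> word_eq u w
| word_eq_cat u u' v v' :
    word_eq u u' -> word_eq v v' -> word_eq (u ++ v) (u' ++ v')
| word_eq_cancel x b : word_eq [:: (x, b); (x, ~~ b)] [::]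
| word_eq_relator u : relator u -> word_eq u [::].

Definition word_eqb (u v : word X) := `[< word_eq u v >].

Lemma word_eqb_equiv : equiv_class_of word_eqb.
Proof.
split=> [u|u v|v u w]; first by apply/asboolP; exact: word_eq_refl.
- by apply/asboolP/asboolP; exact: word_eq_sym.
by move=> /asboolP uv /asboolP vw; apply/asboolP; exact: word_eq_trans uv vw.
Qed.

Canonical word_eqb_canonical := EquivRelPack word_eqb_equiv.
Canonical word_eqb_encModRel := defaultEncModRel word_eqb.

Definition presented := {eq_quot word_eqb}.
HB.instance Definition _ := Choice.on presented.
HB.instance Definition _ : EqQuotient (word X) word_eqb presented :=
  EqQuotient.on presented.

Definition word_inv (u : word X) : word X :=
  rev [seq (p.1, ~~ p.2) | p <- u].

Definition pres_one : presented := \pi_presented [::].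
Definition pres_mul (a b : presented) : presented :=
  \pi_presented (repr a ++ repr b).
Definition pres_inv (a : presented) : presented :=
  \pi_presented (word_inv (repr a)).

Lemma pres_eqP u v : reflect (word_eq u v) (\pi_presented u == \pi_presented v).
Proof. by rewrite piE; exact: asboolP. Qed.

Lemma word_eq_repr u : word_eq (repr (\pi_presented u)) u.
Proof. by apply/pres_eqP; rewrite reprK. Qed.

Lemma pres_mulE u v : pres_mul (\pi_presented u) (\pi_presented v) = \pi_presented (u ++ v).
Proof. by apply/eqP/pres_eqP; apply: word_eq_cat; exact: word_eq_repr. Qed.

Lemma word_inv_cat u v : word_inv (u ++ v) = word_inv v ++ word_inv u.
Proof. by rewrite /word_inv map_cat rev_cat. Qed.

Lemma word_invK : involutive word_inv.
Proof.
move=> u; rewrite /word_inv map_rev revK -map_comp -[RHS]map_id.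
by apply: eq_map => -[x b] /=; rewrite negbK.
Qed.

Lemma word_mulV u : word_eq (u ++ word_inv u) [::].
Proof.
elim: u => [|[x b] u IHu]; first exact: word_eq_refl.
rewrite -[(x, b) :: u]cat1s word_inv_cat -catA.
apply: word_eq_trans (word_eq_cancel x b); rewrite -[X in word_eq _ X]cat1s.
apply: word_eq_cat; first exact: word_eq_refl.
rewrite catA -[X in word_eq _ X]cat0s.
by apply: word_eq_cat IHu _; exact: word_eq_refl.
Qed.

Lemma word_inv_eq u v : word_eq u v -> word_eq (word_inv u) (word_inv v).
Proof.
move=> uv.
have h1 : word_eq (word_inv u ++ v ++ word_inv v) (word_inv u).
  rewrite -[X in word_eq _ X]cats0; apply: word_eq_cat (word_mulV v).
  exact: word_eq_refl.
apply: word_eq_trans (word_eq_sym h1) _.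
rewrite catA -[X in word_eq _ X]cat0s.
apply: word_eq_cat; last exact: word_eq_refl.
apply: word_eq_trans (_ : word_eq (word_inv u ++ u) _).
  by apply: word_eq_cat (word_eq_refl _) (word_eq_sym uv).
by have := word_mulV (word_inv u); rewrite word_invK.
Qed.

Lemma pres_invE u : pres_inv (\pi_presented u) = \pi_presented (word_inv u).
Proof. by apply/eqP/pres_eqP; apply: word_inv_eq; exact: word_eq_repr. Qed.

Lemma presP a : exists u, a = \pi_presented u.
Proof. by exists (repr a); rewrite reprK. Qed.

Lemma pres_mulA : associative pres_mul.
Proof.
move=> a b c; have [u ->] := presP a; have [v ->] := presP b.
by have [w ->] := presP c; rewrite !pres_mulE catA.
Qed.

Lemma pres_mul1 : left_id pres_one pres_mul.
Proof. by move=> a; have [u ->] := presP a; rewrite pres_mulE. Qed.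

Lemma pres_mulr1 : right_id pres_one pres_mul.
Proof. by move=> a; have [u ->] := presP a; rewrite pres_mulE cats0. Qed.

Lemma pres_mulrV : right_inverse pres_one pres_inv pres_mul.
Proof.
move=> a; have [u ->] := presP a; rewrite pres_invE pres_mulE.
by apply/eqP/pres_eqP; exact: word_mulV.
Qed.

Lemma pres_mulV : left_inverse pres_one pres_inv pres_mul.
Proof.
move=> a; have [u ->] := presP a; rewrite pres_invE pres_mulE.
apply/eqP/pres_eqP.
by have := word_mulV (word_inv u); rewrite word_invK.
Qed.

HB.instance Definition _ := isGroup.Build presented
  pres_mulA pres_mul1 pres_mulr1 pres_mulV pres_mulrV.

End Presentation.

Section OrientedRAAG.
Variable g : specialGraph.

(* With e = (o, t): t o t^-1 o^-1 for a normal e, t o t^-1 o for a special e. *)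
Definition raag_word (e : vertex g * vertex g) : word (vertex g) :=
  let: (o, t) := e in
  [:: (t, false); (o, false); (t, true); (o, e \in normal_edges g)].

Definition raag_relator (u : word (vertex g)) : Prop :=
  exists2 e, e \in arcs g & u = raag_word e.

Definition oriented_raag : groupType := presented raag_relator.

End OrientedRAAG.

(* The inhomogeneous bar complex. A degree n cochain is a map G^n -> F_2, and
   the union of all G^n is seq G, so that the direct sum over n of the groups
   of degree n cochains is the group of maps seq G -> F_2 which vanish on all
   long enough sequences; a cochain of degree n is one that is supported on
   the sequences of size n. All signs are trivial over F_2. *)

Section CochainOps.
Variable G : groupType.
Implicit Types (f g h : seq G -> 'F_2) (s : seq G).

(* For s = [:: g_1; ...; g_n], the i-th face is [:: g_2; ...; g_n] if i = 0,
   [:: g_1; ...; g_i g_(i+1); ...; g_n] if 0 < i < n, and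
   [:: g_1; ...; g_(n-1)] if i = n. *)
Definition face (i : nat) s : seq G :=
  if i is j.+1 then
    if (i < size s)%N then
      take j s ++ (nth 1 s j * nth 1 s i)%g :: drop i.+1 s
    else take j s
  else behead s.

Definition cobound f s : 'F_2 :=
  if s is [::] then 0 else \sum_(i < (size s).+1) f (face i s).

Definition cup f g s : 'F_2 :=
  \sum_(i < (size s).+1) f (take i s) * g (drop i s).

Definition bounded f := exists N, forall s, (N <= size s)%N -> f s = 0.

Fixpoint tail_faces f x s : 'F_2 :=
  if s is y :: s' then f ((x * y)%g :: s') + tail_faces (f \o cons x) y s'
  else f [::].

Lemma tail_facesE f x s :
  \sum_(i < (size s).+1) f (face i.+1 (x :: s)) = tail_faces f x s.
Proof.
elim: s f x => [|y s IHs] f x /=; first by rewrite big_ord1.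
rewrite big_ord_recl /= drop0; congr (_ + _).
by rewrite -IHs; apply: eq_bigr => i _; rewrite /= !ltnS; case: ifP.
Qed.

Lemma cobound_cons f x s : cobound f (x :: s) = f s + tail_faces f x s.
Proof. by rewrite /cobound big_ord_recl /= tail_facesE. Qed.

Lemma cup_nil f g : cup f g [::] = f [::] * g [::].
Proof. by rewrite /cup big_ord1. Qed.

Lemma cup_cons f g x s :
  cup f g (x :: s) = f [::] * g (x :: s) + cup (f \o cons x) g s.
Proof. by rewrite /cup big_ord_recl. Qed.

Lemma cupDl f f' g s : cup (fun t => f t + f' t) g s = cup f g s + cup f' g s.
Proof. by rewrite -big_split; apply: eq_bigr => i _; rewrite mulrDl. Qed.

Lemma cupDr f g g' s : cup f (fun t => g t + g' t) s = cup f g s + cup f g' s.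
Proof. by rewrite -big_split; apply: eq_bigr => i _; rewrite mulrDr. Qed.

Lemma cupZl c f g s : cup (fun t => c * f t) g s = c * cup f g s.
Proof. by rewrite /cup big_distrr; apply: eq_bigr => i _; rewrite /= mulrA. Qed.

Lemma eq_cup f f' g g' : f =1 f' -> g =1 g' -> cup f g =1 cup f' g'.
Proof. by move=> ff' gg' s; apply: eq_bigr => i _; rewrite ff' gg'. Qed.

Lemma cupA f g h s : cup f (cup g h) s = cup (cup f g) h s.
Proof.
elim: s f g => [|x s IHs] f g; first by rewrite !cup_nil mulrA.
rewrite !cup_cons IHs cup_nil mulrDr mulrA -addrA; congr (_ + _).
rewrite -cupZl -cupDl; apply: eq_cup => // t.
by rewrite /= cup_cons.
Qed.

Definition unit_fun s : 'F_2 := (s == [::])%:R.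

Lemma cup1 f s : cup unit_fun f s = f s.
Proof.
rewrite /cup big_ord_recl /= take0 drop0 mul1r big1 ?addr0 // => i _.
by case: s i => [[]|x s i]; rewrite // mul0r.
Qed.

Lemma cupr1 f s : cup f unit_fun s = f s.
Proof.
rewrite /cup big_ord_recr /= drop_size take_size mulr1 big1 ?add0r // => i _.
by rewrite /unit_fun -size_eq0 size_drop subn_eq0 leqNgt ltn_ord mulr0.
Qed.

Lemma addF2 (c : 'F_2) : c + c = 0.
Proof. exact/addrr_pchar2/pchar_Fp. Qed.

Lemma oppF2 (c : 'F_2) : - c = c.
Proof. exact/oppr_pchar2/pchar_Fp. Qed.

Lemma eq_tail_faces f f' x : f =1 f' -> tail_faces f x =1 tail_faces f' x.
Proof. by move=> ff' s; rewrite -!tail_facesE; apply: eq_bigr. Qed.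

Lemma tail_facesD f f' x s :
  tail_faces (fun t => f t + f' t) x s = tail_faces f x s + tail_faces f' x s.
Proof. by rewrite -!tail_facesE big_split. Qed.

Lemma tail_facesZ c f x s :
  tail_faces (fun t => c * f t) x s = c * tail_faces f x s.
Proof. by rewrite -!tail_facesE big_distrr. Qed.

Lemma tail_faces_cup f g x s :
  tail_faces (cup f g) x s =
    cup (tail_faces f x) g s + f [::] * g s + f [::] * tail_faces g x s
    + cup (f \o cons x) (cobound g) s.
Proof.
elim: s f x => [|y s IHs] f x.
  by rewrite /= !cup_nil /= mulr0 addr0 addF2 add0r.
rewrite [LHS]/= cup_cons (@eq_tail_faces _ (fun t => f [::] * g (x :: t) +
  cup (f \o cons x) g t)); last by move=> t; rewrite /= cup_cons.
rewrite tail_facesD tail_facesZ IHs [cup (tail_faces f x) g _]cup_cons.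
rewrite [cup (f \o cons x) _ (y :: s)]cup_cons cobound_cons /=.
rewrite (@eq_cup (tail_faces f x \o cons y)
  (fun t => (f \o cons (x * y)%g) t + tail_faces (f \o cons x) y t) g g) //.
rewrite cupDl -[LHS]addr0 -(addF2 (f [::] * g (y :: s))); ring.
Qed.

Lemma tail_faces_cons f x y s :
  tail_faces f x (y :: s) = f ((x * y)%g :: s) + tail_faces (f \o cons x) y s.
Proof. by []. Qed.

Lemma tail_facesK f x y s :
  tail_faces (tail_faces f x) y s = tail_faces f (x * y)%g s.
Proof.
elim: s f x y => [//|z s IHs] f x y; rewrite [LHS]tail_faces_cons [RHS]tail_faces_cons.
rewrite [tail_faces f x _]tail_faces_cons.
rewrite (@eq_tail_faces (tail_faces f x \o cons y)
  (fun t => (f \o cons (x * y)%g) t + tail_faces (f \o cons x) y t)) //.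
rewrite tail_facesD IHs mulgA.
by rewrite addrACA addF2 addr0.
Qed.

Lemma coboundK f s : cobound (cobound f) s = 0.
Proof.
case: s => [//|x s]; rewrite cobound_cons.
suff -> : tail_faces (cobound f) x s = cobound f s by exact: addF2.
case: s => [//|y s]; rewrite tail_faces_cons.
rewrite (@eq_tail_faces (cobound f \o cons x)
  (fun t => f t + tail_faces f x t)); last by move=> t; exact: cobound_cons.
rewrite tail_facesD tail_facesK !cobound_cons.
by rewrite addrACA addF2 addr0.
Qed.

End CochainOps.

Section Cochains.
Variable G : groupType.

Record cochain := Cochain {
  cochain_val :> seq G -> 'F_2;
  cochain_bounded : `[< bounded cochain_val >]
}.

HB.instance Definition _ := [isSub for cochain_val].
HB.instance Definition _ := [Choice of cochain by <:].

Implicit Types f g h : cochain.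

Lemma cochainP f g : f =1 g -> f = g.
Proof. by move=> fg; apply: val_inj; apply: funext. Qed.

Lemma cochain_boundedP f : bounded f.
Proof. exact/asboolP/cochain_bounded. Qed.

Lemma zero_bounded : bounded (fun _ : seq G => 0).
Proof. by exists 0. Qed.

Lemma add_bounded f g : bounded (fun s => f s + g s).
Proof.
have [N fN] := cochain_boundedP f; have [M gM] := cochain_boundedP g.
exists (N + M)%N => s le_s; rewrite fN ?gM ?addr0 //.
  by apply: leq_trans le_s; exact: leq_addl.
by apply: leq_trans le_s; exact: leq_addr.
Qed.

Lemma one_bounded : bounded (@unit_fun G).
Proof. by exists 1 => -[]. Qed.

Lemma cup_bounded f g : bounded (cup f g).
Proof.
have [N fN] := cochain_boundedP f; have [M gM] := cochain_boundedP g.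
exists (N + M)%N => s le_s; rewrite /cup big1 // => i _.
have le_i : (i <= size s)%N by rewrite -ltnS.
have [leNi|lt_iN] := leqP N i.
  by rewrite fN ?mul0r // size_takel.
rewrite gM ?mulr0 // size_drop leq_subRL //.
by apply: leq_trans le_s; rewrite leq_add2r ltnW.
Qed.

Definition zero_cochain := Cochain (introT (asboolP _) zero_bounded).
Definition add_cochain f g := Cochain (introT (asboolP _) (add_bounded f g)).
Definition one_cochain := Cochain (introT (asboolP _) one_bounded).
Definition cup_cochain f g := Cochain (introT (asboolP _) (cup_bounded f g)).

Lemma cochain_addA : associative add_cochain.
Proof. by move=> f g h; apply: cochainP => s; exact: addrA. Qed.
Lemma cochain_addC : commutative add_cochain.
Proof. by move=> f g; apply: cochainP => s; exact: addrC. Qed.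
Lemma cochain_add0 : left_id zero_cochain add_cochain.
Proof. by move=> f; apply: cochainP => s; exact: add0r. Qed.
Lemma cochain_addN : left_inverse zero_cochain id add_cochain.
Proof. by move=> f; apply: cochainP => s; exact: addF2. Qed.
Lemma cochain_cupA : associative cup_cochain.
Proof. by move=> f g h; apply: cochainP => s; exact: cupA. Qed.
Lemma cochain_cup1 : left_id one_cochain cup_cochain.
Proof. by move=> f; apply: cochainP => s; exact: cup1. Qed.
Lemma cochain_cupr1 : right_id one_cochain cup_cochain.
Proof. by move=> f; apply: cochainP => s; exact: cupr1. Qed.
Lemma cochain_cupDl : left_distributive cup_cochain add_cochain.
Proof. by move=> f g h; apply: cochainP => s; exact: cupDl. Qed.
Lemma cochain_cupDr : right_distributive cup_cochain add_cochain.
Proof. by move=> f g h; apply: cochainP => s; exact: cupDr. Qed.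

HB.instance Definition _ := GRing.isPzRing.Build cochain
  cochain_addA cochain_addC cochain_add0 cochain_addN cochain_cupA
  cochain_cup1 cochain_cupr1 cochain_cupDl cochain_cupDr.

Lemma cobound0 s : cobound (0 : cochain) s = 0.
Proof. by case: s => // x s; rewrite /cobound big1. Qed.

Lemma coboundD f g s : cobound (f + g) s = cobound f s + cobound g s.
Proof. by case: s => [|x s]; rewrite /= ?addr0 // -big_split. Qed.

Lemma coboundM f g s :
  cobound (f * g) s = cup (cobound f) g s + cup f (cobound g) s.
Proof.
rewrite -[cochain_val (f * g)]/(cup f g).
case: s => [|x s]; first by rewrite !cup_nil mul0r mulr0 addr0.
rewrite cobound_cons tail_faces_cup !cup_cons cobound_cons mul0r add0r mulrDr.
rewrite (@eq_cup _ (cobound f \o cons x) (fun t => f t + tail_faces f x t) g g) //.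
  by rewrite cupDl; ring.
by move=> t; exact: cobound_cons.
Qed.

Definition is_cocycle : {pred cochain} :=
  fun f => `[< cobound f =1 fun=> 0 >].

Lemma cocycle_subring_closed : subring_closed is_cocycle.
Proof.
split=> [|f g /asboolP Zf /asboolP Zg|f g /asboolP Zf /asboolP Zg].
- apply/asboolP => -[|x s]; first by [].
  rewrite cobound_cons; case: s => [|y s]; first exact: addF2.
  by rewrite /= /unit_fun /= !add0r -tail_facesE big1.
- by apply/asboolP => s; rewrite coboundD Zf add0r Zg.
apply/asboolP => s; rewrite coboundM /cup !big1 ?addr0 // => i _.
  by rewrite Zg mulr0.
by rewrite Zf mul0r.
Qed.

HB.instance Definition _ :=
  GRing.isSubringClosed.Build cochain is_cocycle cocycle_subring_closed.

Record cocycle := Cocycle {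
  cocycle_val :> cochain;
  cocycleP : cocycle_val \in is_cocycle
}.

HB.instance Definition _ := [isSub for cocycle_val].
HB.instance Definition _ := [Choice of cocycle by <:].
HB.instance Definition _ :=
  GRing.SubChoice_isSubPzRing.Build cochain is_cocycle cocycle
    cocycle_subring_closed.

Definition is_coboundary : {pred cocycle} :=
  fun z => `[< exists c : cochain, z =1 cobound c >].

Lemma coboundary_zmod_closed : zmod_closed is_coboundary.
Proof.
split=> [|y z /asboolP[b yb] /asboolP[c zc]]; apply/asboolP.
  by exists 0 => s; rewrite cobound0.
by exists (b + c) => s; rewrite coboundD -yb -zc.
Qed.

HB.instance Definition _ :=
  GRing.isZmodClosed.Build cocycle is_coboundary coboundary_zmod_closed.

Lemma coboundaryMl (z y : cocycle) :
  y \in is_coboundary -> z * y \in is_coboundary.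
Proof.
move=> /asboolP[c yc]; apply/asboolP; exists (cocycle_val z * c) => s.
rewrite coboundM [X in _ = X + _]big1 ?add0r; last first.
  by move=> i _; have /asboolP -> := cocycleP z; rewrite mul0r.
exact: eq_cup.
Qed.

Lemma coboundaryMr (z y : cocycle) :
  y \in is_coboundary -> y * z \in is_coboundary.
Proof.
move=> /asboolP[c yc]; apply/asboolP; exists (c * cocycle_val z) => s.
rewrite coboundM [X in _ = _ + X]big1 ?addr0; last first.
  by move=> i _; have /asboolP -> := cocycleP z; rewrite mulr0.
exact: eq_cup.
Qed.

Definition cohomology := Quotient.quot is_coboundary.
HB.instance Definition _ := GRing.Zmodule.on cohomology.
HB.instance Definition _ := Quotient.on cohomology.

Definition coclass (z : cocycle) : cohomology := \pi_cohomology z.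

Lemma coclass_eq y z : coclass y = coclass z <-> y - z \in is_coboundary.
Proof. by rewrite Quotient.idealrBE; split=> /eqP. Qed.

Lemma coclassP x : exists z, x = coclass z.
Proof. by exists (repr x); rewrite /coclass reprK. Qed.

Lemma coclassD y z : coclass (y + z) = coclass y + coclass z.
Proof. by rewrite /coclass !piE. Qed.

Definition cohom_one := coclass 1.
Definition cohom_mul (x y : cohomology) := coclass (repr x * repr y).

Lemma cohom_mulE y z : cohom_mul (coclass y) (coclass z) = coclass (y * z).
Proof.
have hrep u : repr (coclass u) - u \in is_coboundary.
  by apply/coclass_eq; rewrite /coclass reprK.
apply/coclass_eq; set y' := repr _; set z' := repr _.
have -> : y' * z' - y * z = (y' - y) * z' + y * (z' - z).
  by rewrite mulrBl mulrBr addrA subrK.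
by apply: rpredD; [apply: coboundaryMr | apply: coboundaryMl]; exact: hrep.
Qed.

Lemma cohom_mulA : associative cohom_mul.
Proof.
move=> a b c; have [x ->] := coclassP a; have [y ->] := coclassP b.
by have [z ->] := coclassP c; rewrite !cohom_mulE mulrA.
Qed.

Lemma cohom_mul1 : left_id cohom_one cohom_mul.
Proof. by move=> a; have [x ->] := coclassP a; rewrite cohom_mulE mul1r. Qed.

Lemma cohom_mulr1 : right_id cohom_one cohom_mul.
Proof. by move=> a; have [x ->] := coclassP a; rewrite cohom_mulE mulr1. Qed.

Lemma cohom_mulDl : left_distributive cohom_mul +%R.
Proof.
move=> a b c; have [x ->] := coclassP a; have [y ->] := coclassP b.
have [z ->] := coclassP c.
by rewrite -coclassD !cohom_mulE mulrDl coclassD.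
Qed.

Lemma cohom_mulDr : right_distributive cohom_mul +%R.
Proof.
move=> a b c; have [x ->] := coclassP a; have [y ->] := coclassP b.
have [z ->] := coclassP c.
by rewrite -coclassD !cohom_mulE mulrDr coclassD.
Qed.

HB.instance Definition _ := GRing.Zmodule_isPzRing.Build cohomology
  cohom_mulA cohom_mul1 cohom_mulr1 cohom_mulDl cohom_mulDr.

Definition cohomology_deg (d : nat) (x : cohomology) : Prop :=
  exists2 z : cocycle, (forall s, size s != d -> z s = 0) & x = coclass z.

End Cochains.

Section QuotientAlgebra.
Variables (k : comNzRingType) (R : comAlgType k) (I : idealr R).
Local Notation Q := (Quotient.quot I).

Lemma ideal_scale c u : u \in (I : {pred R}) -> c *: u \in (I : {pred R}).
Proof. by move=> Iu; rewrite -mulr_algl; exact: idealMr. Qed.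

Lemma quotP (x : Q) : exists u : R, x = \pi_Q u.
Proof. by exists (repr x); rewrite reprK. Qed.

Definition quot_scale (c : k) (x : Q) : Q := \pi_Q (c *: repr x).

Lemma quot_scaleE c u : quot_scale c (\pi_Q u) = \pi_Q (c *: u).
Proof.
apply/eqP; rewrite -Quotient.idealrBE -scalerBr ideal_scale //.
by rewrite Quotient.idealrBE reprK.
Qed.

Lemma quot_scaleA a b x : quot_scale a (quot_scale b x) = quot_scale (a * b) x.
Proof. by have [u ->] := quotP x; rewrite !quot_scaleE scalerA. Qed.

Lemma quot_scale1 : left_id 1 quot_scale.
Proof. by move=> x; have [u ->] := quotP x; rewrite quot_scaleE scale1r. Qed.

Lemma quot_scaleDr : right_distributive quot_scale +%R.
Proof.
move=> a x y; have [u ->] := quotP x; have [v ->] := quotP y.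
by rewrite -rmorphD !quot_scaleE scalerDr rmorphD.
Qed.

Lemma quot_scaleDl x : {morph quot_scale^~ x : a b / a + b}.
Proof.
by move=> a b; have [u ->] := quotP x; rewrite !quot_scaleE scalerDl rmorphD.
Qed.

HB.instance Definition _ := GRing.Zmodule_isLmodule.Build k Q
  quot_scaleA quot_scale1 quot_scaleDr quot_scaleDl.

Lemma quot_scaleAl (a : k) (x y : Q) : a *: (x * y) = (a *: x) * y.
Proof.
have [u ->] := quotP x; have [v ->] := quotP y.
have piZ w : a *: \pi_Q w = \pi_Q (a *: w) by exact: quot_scaleE.
by rewrite -rmorphM !piZ scalerAl rmorphM.
Qed.

HB.instance Definition _ := GRing.Lmodule_isLalgebra.Build k Q quot_scaleAl.
HB.instance Definition _ := GRing.Lalgebra_isComAlgebra.Build k Q.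

End QuotientAlgebra.

Definition ideal_span (R : comNzRingType) (s : seq R) : {pred R} :=
  fun p => `[< exists c : nat -> R, p = \sum_(i < size s) c i * s`_i >].

Section Tensor.
Variables (k : comNzRingType) (A B : algType k).
Implicit Types (s t u : seq (A * B)).

(* The sequence [:: (a_1, b_1); ...; (a_n, b_n)] stands for the sum of the
   pure tensors a_i (x) b_i. *)
Inductive tensor_eq : seq (A * B) -> seq (A * B) -> Prop :=
| tensor_eq_refl s : tensor_eq s s
| tensor_eq_sym s t : tensor_eq s t -> tensor_eq t s
| tensor_eq_trans s t u : tensor_eq s t -> tensor_eq t u -> tensor_eq s u
| tensor_eq_cat s s' t t' :
    tensor_eq s s' -> tensor_eq t t' -> tensor_eq (s ++ t) (s' ++ t')
| tensor_eq_swap p q : tensor_eq [:: p; q] [:: q; p]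
| tensor_eq_0l b : tensor_eq [:: (0, b)] [::]
| tensor_eq_Dl a a' b : tensor_eq [:: (a + a', b)] [:: (a, b); (a', b)]
| tensor_eq_Dr a b b' : tensor_eq [:: (a, b + b')] [:: (a, b); (a, b')]
| tensor_eq_Z (c : k) a b : tensor_eq [:: (c *: a, b)] [:: (a, c *: b)].

Definition tensor_eqb s t := `[< tensor_eq s t >].

Lemma tensor_eqb_equiv : equiv_class_of tensor_eqb.
Proof.
split=> [s|s t|t s u]; first by apply/asboolP; exact: tensor_eq_refl.
- by apply/asboolP/asboolP; exact: tensor_eq_sym.
by move=> /asboolP st /asboolP tu; apply/asboolP; exact: tensor_eq_trans st tu.
Qed.

Canonical tensor_eqb_canonical := EquivRelPack tensor_eqb_equiv.
Canonical tensor_eqb_encModRel := defaultEncModRel tensor_eqb.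

Definition tensor := {eq_quot tensor_eqb}.
HB.instance Definition _ := Choice.on tensor.
HB.instance Definition _ : EqQuotient (seq (A * B)) tensor_eqb tensor :=
  EqQuotient.on tensor.

Definition tclass s : tensor := \pi_tensor s.

Lemma tclass_eq s t : tclass s = tclass t <-> tensor_eq s t.
Proof.
split=> [/eqP|st]; first by rewrite piE => /asboolP.
by apply/eqP; rewrite piE; apply/asboolP.
Qed.

Lemma tclassP (x : tensor) : exists s, x = tclass s.
Proof. by exists (repr x); rewrite /tclass reprK. Qed.

Lemma tensor_eq_repr s : tensor_eq (repr (tclass s)) s.
Proof. by apply/tclass_eq; rewrite /tclass reprK. Qed.

(* The sum is concatenation and (a (x) b) (a' (x) b') = aa' (x) bb'. *)

Definition seq_opp s : seq (A * B) := [seq (- p.1, p.2) | p <- s].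
Definition seq_mul s t : seq (A * B) :=
  [seq (p.1 * q.1, p.2 * q.2) | p <- s, q <- t].

Definition tensor_zero := tclass [::].
Definition tensor_add (x y : tensor) := tclass (repr x ++ repr y).
Definition tensor_opp (x : tensor) := tclass (seq_opp (repr x)).
Definition tensor_one := tclass [:: (1, 1)].
Definition tensor_mul (x y : tensor) := tclass (seq_mul (repr x) (repr y)).

Lemma perm_tensor_eq s t : perm_eq s t -> tensor_eq s t.
Proof.
have aux p u v : tensor_eq (p :: u ++ v) (u ++ p :: v).
  elim: u => [|q u IHu]; first exact: tensor_eq_refl.
  apply: (@tensor_eq_trans _ (q :: p :: u ++ v)).
    exact: tensor_eq_cat (tensor_eq_swap p q) (tensor_eq_refl (u ++ v)).
  exact: tensor_eq_cat (tensor_eq_refl [:: q]) IHu.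
elim: s t => [|p s IHs] t pst.
  by rewrite perm_sym in pst; rewrite (perm_nilP pst); exact: tensor_eq_refl.
have pt : p \in t by rewrite -(perm_mem pst) mem_head.
case/path.splitPr: pt pst => u v pst.
apply: (@tensor_eq_trans _ (p :: u ++ v)); last exact: aux.
apply: tensor_eq_cat (tensor_eq_refl [:: p]) (IHs _ _).
by rewrite -(perm_cons p) (perm_trans pst) // -cat1s perm_catCA.
Qed.

Lemma tensor_addE s t : tensor_add (tclass s) (tclass t) = tclass (s ++ t).
Proof. by apply/tclass_eq; apply: tensor_eq_cat; exact: tensor_eq_repr. Qed.

Lemma seq_opp_eq s t : tensor_eq s t -> tensor_eq (seq_opp s) (seq_opp t).
Proof.
elim=> {s t} /= [s|s t _|s t u _ st _|s s' t t' _ ss' _|p q|b|a a' b|a b b'|c a b].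
- exact: tensor_eq_refl.
- exact: tensor_eq_sym.
- exact: tensor_eq_trans.
- by rewrite /seq_opp !map_cat; exact: tensor_eq_cat.
- exact: tensor_eq_swap.
- by rewrite oppr0; exact: tensor_eq_0l.
- by rewrite opprD; exact: tensor_eq_Dl.
- exact: tensor_eq_Dr.
by rewrite -scalerN; exact: tensor_eq_Z.
Qed.

Lemma tensor_oppE s : tensor_opp (tclass s) = tclass (seq_opp s).
Proof. by apply/tclass_eq; apply: seq_opp_eq; exact: tensor_eq_repr. Qed.

Lemma seq_oppK s : tensor_eq (seq_opp s ++ s) [::].
Proof.
elim: s => [|[a b] s IHs] /=; first exact: tensor_eq_refl.
apply: (@tensor_eq_trans _ ([:: (- a, b); (a, b)] ++ (seq_opp s ++ s))).
  apply: perm_tensor_eq; rewrite /= perm_cons.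
  by rewrite -cat1s perm_catCA.
rewrite -[X in tensor_eq _ X]cats0; apply: tensor_eq_cat IHs.
apply: tensor_eq_trans (tensor_eq_sym (tensor_eq_Dl _ _ _)) _.
by rewrite addNr; exact: tensor_eq_0l.
Qed.

Lemma seq_mul_catl s s' t : seq_mul (s ++ s') t = seq_mul s t ++ seq_mul s' t.
Proof. by rewrite /seq_mul allpairs_cat. Qed.

Lemma seq_mul_catr s t t' :
  perm_eq (seq_mul s (t ++ t')) (seq_mul s t ++ seq_mul s t').
Proof.
apply/permPl.
exact: (perm_allpairs_catr (fun p q => (p.1 * q.1, p.2 * q.2))
          s (fun=> t) (fun=> t')).
Qed.

Lemma seq_mul_nil s : seq_mul s [::] = [::].
Proof. by elim: s. Qed.

Lemma seq_mul_eql s s' t :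
  tensor_eq s s' -> tensor_eq (seq_mul s t) (seq_mul s' t).
Proof.
move=> ss'; elim: t => [|[x y] t IHt].
  by rewrite !seq_mul_nil; exact: tensor_eq_refl.
rewrite -[_ :: t]cat1s.
apply: tensor_eq_trans (perm_tensor_eq (seq_mul_catr _ _ _)) _.
apply: tensor_eq_sym.
apply: tensor_eq_trans (perm_tensor_eq (seq_mul_catr _ _ _)) _.
apply: tensor_eq_sym; apply: tensor_eq_cat IHt.
elim: ss' => {s s'} /= [s|s u _|s u v _ su _|s s' u u' _ ss' _|p q|b|a a' b
  |a b b'|c a b].
- exact: tensor_eq_refl.
- exact: tensor_eq_sym.
- exact: tensor_eq_trans.
- by rewrite !seq_mul_catl; exact: tensor_eq_cat.
- exact: tensor_eq_swap.
- by rewrite /seq_mul /= mul0r; exact: tensor_eq_0l.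
- by rewrite /seq_mul /= mulrDl; exact: tensor_eq_Dl.
- by rewrite /seq_mul /= mulrDl; exact: tensor_eq_Dr.
by rewrite /seq_mul /= -!scalerAl; exact: tensor_eq_Z.
Qed.

Lemma seq_mul_eqr s t t' :
  tensor_eq t t' -> tensor_eq (seq_mul s t) (seq_mul s t').
Proof.
move=> tt'; elim: s => [|[x y] s IHs]; first exact: tensor_eq_refl.
rewrite -[_ :: s]cat1s !seq_mul_catl; apply: tensor_eq_cat IHs.
elim: tt' => {t t'} /= [t|t u _|t u v _ tu _|t t' u u' _ tt' _|p q|b|a a' b
  |a b b'|c a b].
- exact: tensor_eq_refl.
- exact: tensor_eq_sym.
- exact: tensor_eq_trans.
- by rewrite /seq_mul /= !cats0 !map_cat in tt' *; exact: tensor_eq_cat.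
- exact: tensor_eq_swap.
- by rewrite /seq_mul /= mulr0; exact: tensor_eq_0l.
- by rewrite /seq_mul /= mulrDr; exact: tensor_eq_Dl.
- by rewrite /seq_mul /= mulrDr; exact: tensor_eq_Dr.
by rewrite /seq_mul /= -!scalerAr; exact: tensor_eq_Z.
Qed.

Lemma tensor_mulE s t : tensor_mul (tclass s) (tclass t) = tclass (seq_mul s t).
Proof.
apply/tclass_eq; apply: (@tensor_eq_trans _ (seq_mul s (repr (tclass t)))).
  exact/seq_mul_eql/tensor_eq_repr.
exact/seq_mul_eqr/tensor_eq_repr.
Qed.

Lemma tensor_addA : associative tensor_add.
Proof.
move=> x y z; have [s ->] := tclassP x; have [t ->] := tclassP y.
by have [u ->] := tclassP z; rewrite !tensor_addE catA.
Qed.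

Lemma tensor_addC : commutative tensor_add.
Proof.
move=> x y; have [s ->] := tclassP x; have [t ->] := tclassP y.
rewrite !tensor_addE; apply/tclass_eq/perm_tensor_eq.
by rewrite perm_catC.
Qed.

Lemma tensor_add0 : left_id tensor_zero tensor_add.
Proof. by move=> x; have [s ->] := tclassP x; rewrite tensor_addE. Qed.

Lemma tensor_addN : left_inverse tensor_zero tensor_opp tensor_add.
Proof.
move=> x; have [s ->] := tclassP x; rewrite tensor_oppE tensor_addE.
by apply/tclass_eq; exact: seq_oppK.
Qed.

Lemma tensor_mulA : associative tensor_mul.
Proof.
move=> x y z; have [s ->] := tclassP x; have [t ->] := tclassP y.
have [u ->] := tclassP z; rewrite !tensor_mulE; congr tclass.
elim: s => [|p s IHs] //=.
rewrite -[p :: s]cat1s !seq_mul_catl -{}IHs; congr (_ ++ _).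
rewrite /seq_mul /= !cats0.
elim: t => [|q t IHt] //=.
rewrite map_cat IHt; congr (_ ++ _).
by rewrite -map_comp; apply: eq_map => v; rewrite /= !mulrA.
Qed.

Lemma tensor_mul1 : left_id tensor_one tensor_mul.
Proof.
move=> x; have [s ->] := tclassP x; rewrite tensor_mulE; congr tclass.
rewrite /seq_mul /= cats0 -[RHS]map_id.
by apply: eq_map => -[a b]; rewrite /= !mul1r.
Qed.

Lemma tensor_mulr1 : right_id tensor_one tensor_mul.
Proof.
move=> x; have [s ->] := tclassP x; rewrite tensor_mulE; congr tclass.
elim: s => [|[a b] s IHs] //.
by rewrite -[_ :: s]cat1s seq_mul_catl IHs /seq_mul /= !mulr1.
Qed.

Lemma tensor_mulDl : left_distributive tensor_mul tensor_add.
Proof.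
move=> x y z; have [s ->] := tclassP x; have [t ->] := tclassP y.
have [u ->] := tclassP z.
by rewrite tensor_addE !tensor_mulE tensor_addE seq_mul_catl.
Qed.

Lemma tensor_mulDr : right_distributive tensor_mul tensor_add.
Proof.
move=> x y z; have [s ->] := tclassP x; have [t ->] := tclassP y.
have [u ->] := tclassP z; rewrite tensor_addE !tensor_mulE tensor_addE.
by apply/tclass_eq/perm_tensor_eq; exact: seq_mul_catr.
Qed.

HB.instance Definition _ := GRing.isPzRing.Build tensor
  tensor_addA tensor_addC tensor_add0 tensor_addN tensor_mulA
  tensor_mul1 tensor_mulr1 tensor_mulDl tensor_mulDr.

Definition tensor_deg (degA : nat -> A -> Prop) (degB : nat -> B -> Prop)
    (d : nat) (x : tensor) : Prop :=
  exists2 s, x = tclass s &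
    forall p, p \in s ->
      exists i j, [/\ (i + j)%N = d, degA i p.1 & degB j p.2].

End Tensor.

Section PolynomialQuotients.

Lemma ideal_span_proper n (s : seq {mpoly 'F_2[n]}) :
  (forall p, p \in s -> p@_0%MM = 0) -> idealr_closed (ideal_span s).
Proof.
move=> s0; split.
- by apply/asboolP; exists (fun=> 0); rewrite big1 // => i _; rewrite mul0r.
- apply/asboolP => -[c /(congr1 (mcoeff 0%MM))].
  rewrite raddf_sum /= big1 => [/eqP|i _]; last first.
    by rewrite rmorphM /= [X in _ * X]s0 ?mulr0 // mem_nth.
  by rewrite rmorph1 oner_eq0.
move=> a u v /asboolP[c ->] /asboolP[e ->]; apply/asboolP.
exists (fun i => a * c i + e i); rewrite mulr_sumr -big_split.
by apply: eq_bigr => i _; rewrite mulrDl mulrA.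
Qed.

(* The degree d part of the quotient of a polynomial ring, graded by giving
   degree 1 to every variable. *)
Definition poly_quot_deg n (I : idealr {mpoly 'F_2[n]}) (d : nat)
    (x : Quotient.quot I) : Prop :=
  exists2 p : {mpoly 'F_2[n]}, p \is d.-homog & x = \pi p.

Variables r m : nat.

Definition var_R : {mpoly 'F_2[r.+1]} := 'X_ord0.
Definition var_V (i : 'I_r) : {mpoly 'F_2[r.+1]} := 'X_(lift ord0 i).
Definition var_W (j : 'I_m) : {mpoly 'F_2[m]} := 'X_j.

Definition RV_relations : seq {mpoly 'F_2[r.+1]} :=
  var_R ^+ 2 :: [seq var_V i ^+ 2 + var_R * var_V i | i : 'I_r].

Definition W_relations : seq {mpoly 'F_2[m]} := [seq var_W j ^+ 2 | j : 'I_m].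

Definition RV_ideal : {pred {mpoly 'F_2[r.+1]}} := ideal_span RV_relations.
Definition W_ideal : {pred {mpoly 'F_2[m]}} := ideal_span W_relations.

Lemma mcoeff0X n (i : 'I_n) : ('X_i : {mpoly 'F_2[n]})@_0%MM = 0.
Proof. by rewrite mcoeffX mnm1_eq0. Qed.

Lemma RV_ideal_closed : idealr_closed RV_ideal.
Proof.
apply: ideal_span_proper => p; rewrite inE => /orP[/eqP->|/mapP[i _ ->]].
  by rewrite rmorphXn /= mcoeff0X expr0n.
by rewrite rmorphD rmorphXn rmorphM /= !mcoeff0X expr0n mul0r addr0.
Qed.

Lemma W_ideal_closed : idealr_closed W_ideal.
Proof.
apply: ideal_span_proper => p /mapP[i _ ->].
by rewrite rmorphXn /= mcoeff0X expr0n.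
Qed.

HB.instance Definition _ := isIdealr.Build {mpoly 'F_2[r.+1]} RV_ideal
  RV_ideal_closed.
HB.instance Definition _ := isIdealr.Build {mpoly 'F_2[m]} W_ideal
  W_ideal_closed.

Definition RV_algebra : comAlgType 'F_2 := {ideal_quot RV_ideal}.
Definition W_algebra : comAlgType 'F_2 := {ideal_quot W_ideal}.

Definition RV_deg : nat -> RV_algebra -> Prop := @poly_quot_deg _ RV_ideal.
Definition W_deg : nat -> W_algebra -> Prop := @poly_quot_deg _ W_ideal.

Definition target : pzRingType := tensor RV_algebra W_algebra.
Definition target_deg : nat -> target -> Prop := tensor_deg RV_deg W_deg.

End PolynomialQuotients.

(* Main.v *)
(* With [w] the special vertex (or any vertex if there is none), every other
   vertex is either inverted by [w] or commutes with it, and all vertices other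
   than [w] commute. Hence the group acts on the right, simply transitively, on
   the exponent vectors [vertex L -> int] of its normal forms. Cochains with
   values in the functions on this set are acyclic, and letting the functions
   depend on fewer and fewer coordinates, one recovers the cohomology of the
   group: forgetting a coordinate [v] is a step of the Wang exact sequence of
   the translation along [v], which multiplies the additive basis by
   [1 + x v], where [x v] is the parity of the exponent of [v]. So the
   squarefree products of the [x v] form a basis of the cohomology.

   The [x v] commute up to the coboundary of [x u * x v], and
   [x v ^+ 2 = x w * x v] or [0], according to whether [w] inverts [v], up to
   the coboundary of the class mod 2 of [a (a - 1) / 2], [a] the exponent of
   [v]. The universal properties of polynomial rings, quotients and tensor
   products then give a ring morphism from the target to the cohomology; it is
   bijective since the target is spanned by the squarefree products too. *)

From HB Require Import structures.
Require Import Defs.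
From mathcomp Require Import all_boot all_algebra.
From mathcomp Require Import boolp ring mpoly.

Set Implicit Arguments.
Unset Strict Implicit.
Unset Printing Implicit Defensive.

Import GRing.Theory.
Local Open Scope ring_scope.
Local Open Scope quotient_scope.

(** * Cohomology of action groupoids *)

Lemma F2P (c : 'F_2) : c = 0 \/ c = 1.
Proof. by case: c => [[|[|n]] lt_n2] //; [left | right]; apply: val_inj. Qed.

Lemma addF2_eq0 (a b : 'F_2) : a + b = 0 -> a = b.
Proof. by move/eqP; rewrite -{1}[b]oppF2 subr_eq0 => /eqP. Qed.

(** * Linear combinations of squarefree products over the field with two elements *)

Section Comb.
Variable Q : pzRingType.
Implicit Types (ts : seq Q) (c : seq bool -> bool).

(* The coefficient of the product of the subsequence of [ts] selected by the
   mask [m] is [c m]. *)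
Fixpoint comb ts c : Q :=
  if ts is t :: ts' then
    comb ts' (c \o cons false) + t * comb ts' (c \o cons true)
  else (c [::] : nat)%:R.

Lemma comb_eq0 ts c : (forall m, size m = size ts -> c m = false) -> comb ts c = 0.
Proof.
elim: ts c => [|t ts IHts] c c0 /=; first by rewrite c0.
by rewrite !IHts ?mulr0 ?addr0 // => m sm; apply: c0; rewrite /= sm.
Qed.

Lemma comm_comb x ts c :
  {in ts, forall t, GRing.comm x t} -> GRing.comm x (comb ts c).
Proof.
elim: ts c => [|t ts IHts] c xts /=; first exact: commr_nat.
have xts' : {in ts, forall u, GRing.comm x u}.
  by move=> u u_ts; apply: xts; rewrite inE u_ts orbT.
by apply: commrD; [|apply: commrM; first by apply: xts; rewrite mem_head]; apply: IHts.
Qed.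

End Comb.

Lemma combM (Q Q' : pzRingType) (f : {rmorphism Q -> Q'}) ts c :
  f (comb ts c) = comb (map f ts) c.
Proof.
by elim: ts c => [|t ts IHts] c /=; rewrite ?rmorph_nat // rmorphD rmorphM !IHts.
Qed.

(** * Cup products with classes of degree 1 *)

Section CocycleValues.
Variable G : groupType.
Implicit Types (x y : cocycle G) (s : seq G).

Lemma cocycleD x y s : (x + y : cocycle G) s = x s + y s.
Proof. by []. Qed.

Lemma cocycleM x y s : (x * y : cocycle G) s = cup x y s.
Proof. by []. Qed.

Lemma cocycle1 s : (1 : cocycle G) s = unit_fun s.
Proof. by []. Qed.

Lemma cocycle_nat (b : bool) s : ((b : nat)%:R : cocycle G) s = b%:R * unit_fun s.
Proof. by case: b; rewrite ?mul1r ?mul0r. Qed.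

Lemma cocycle_cobound x s : cobound x s = 0.
Proof. by have /asboolP -> := cocycleP x. Qed.

Definition degree1 x := forall s, size s != 1 -> x s = 0.

Lemma degree1M_nil x y : degree1 x -> (x * y : cocycle G) [::] = 0.
Proof. by move=> x1; rewrite cocycleM cup_nil x1 ?mul0r. Qed.

Lemma degree1M_cons x y g s :
  degree1 x -> (x * y : cocycle G) (g :: s) = x [:: g] * y s.
Proof.
move=> x1; rewrite cocycleM cup_cons x1 // mul0r add0r.
rewrite (@eq_cup _ _ (fun t => x [:: g] * unit_fun t) _ y) //.
  by rewrite cupZl cup1.
by case=> [|h t] /=; rewrite ?mulr1 // mulr0 x1.
Qed.

End CocycleValues.

(* A cochain with values in the functions on a right [G]-set [Y] is a cochain
   of the action groupoid of [Y]. *)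
Section ActionCochains.
Variables (G : groupType) (Y : Type) (act : Y -> G -> Y).
Hypothesis actM : forall y g h, act (act y g) h = act y (g * h)%g.
Implicit Types (f h : Y -> seq G -> 'F_2) (s : seq G).

Definition acobound f y s : 'F_2 :=
  if s is g :: s' then f (act y g) s' + tail_faces (f y) g s' else 0.

Lemma acoboundD f h y s :
  acobound (fun y t => f y t + h y t) y s = acobound f y s + acobound h y s.
Proof. by case: s => [|g s] /=; rewrite ?addr0 // tail_facesD addrACA. Qed.

Lemma eq_acobound f h : f =2 h -> acobound f =2 acobound h.
Proof.
by move=> fh y [|g s] //=; rewrite fh; congr (_ + _); apply: eq_tail_faces.
Qed.

Lemma acoboundK f y s : acobound (acobound f) y s = 0.
Proof.
case: s => [|x [|z s]] //=; first exact: addF2.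
rewrite actM (@eq_tail_faces _ (acobound f y \o cons x)
  (fun t => f (act y x) t + tail_faces (f y) x t)) // tail_facesD tail_facesK.
rewrite -[RHS](addF2 (f (act y (x * z)%g) s)) -[RHS]addr0.
rewrite -(addF2 (tail_faces (f (act y x)) z s)).
rewrite -[RHS]addr0 -(addF2 (tail_faces (f y) (x * z)%g s)); ring.
Qed.

Lemma acobound_cst (f : seq G -> 'F_2) y s : acobound (fun=> f) y s = cobound f s.
Proof. by case: s => [|g s] //; rewrite cobound_cons. Qed.

End ActionCochains.

(** * Wang sequences: forgetting coordinates one at a time *)

Section Wang.
Variables (G : groupType) (V : eqType).
Local Notation Y := (V -> int).
Variables (act : Y -> G -> Y) (x : V -> cocycle G).
Hypothesis actM : forall y g h, act (act y g) h = act y (g * h)%g.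
Hypothesis x1 : forall v, degree1 (x v).
Hypothesis act_parity : forall y g v,
  (act y g v)%:~R = (y v)%:~R + x v [:: g] :> 'F_2.
Implicit Types (f h : Y -> seq G -> 'F_2) (y : Y) (v : V) (s : seq V).

Definition agree_off s y y' := forall u, u \notin s -> y u = y' u.

Definition depends_off s f := forall y y', agree_off s y y' -> f y =1 f y'.

(** The coefficients are the functions of the coordinates outside [s]. For empty [s] they form a
    coinduced module; when [s] contains every coordinate they are constants and the complex is the
    bar complex. The induction on [s] carries spanning and, in [products_free], independence modulo
    coboundaries. *)
Definition cocycles_spanned s := forall f, depends_off s f ->
  (forall y t, acobound act f y t = 0) ->
  exists c h, depends_off s h /\
    forall y t, f y t = comb (map x s) c t + acobound act h y t.

Definition products_free s := forall c h, depends_off s h ->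
  (forall y t, comb (map x s) c t = acobound act h y t) ->
  forall m, size m = size s -> c m = false.

Definition set_at y v (k : int) : Y := fun u => if u == v then k else y u.
Definition shift v y := set_at y v (y v + 1).

Lemma set_at_id y v : set_at y v (y v) = y.
Proof. by apply: funext => u; rewrite /set_at; case: eqP => [->|]. Qed.

Lemma set_at_set y v k l : set_at (set_at y v k) v l = set_at y v l.
Proof. by apply: funext => u; rewrite /set_at; case: eqP. Qed.

Lemma set_at_same y v k : set_at y v k v = k.
Proof. by rewrite /set_at eqxx. Qed.

(** The discrete antiderivative along [v] that vanishes where the exponent is 0. The sum over a
    negative range needs no sign in characteristic 2. *)
Definition primitive v f y t : 'F_2 :=
  match y v with
  | Posz n => \sum_(i < n) f (set_at y v i) t
  | Negz n => \sum_(i < n.+1) f (set_at y v (Negz i)) t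
  end.

(** The translation minus the identity is onto; by [shift_invariant] its kernel consists of the
    functions independent of the coordinate [v]. This is the short exact sequence of coefficients
    behind the Wang sequence. *)
Lemma primitiveK v f y t :
  primitive v f (shift v y) t + primitive v f y t = f y t.
Proof.
rewrite /primitive /shift set_at_same.
case yv: (y v) => [n|n].
  have -> : Posz n + 1 = Posz n.+1 by rewrite -addn1.
  rewrite big_ord_recr /= set_at_set -yv set_at_id addrAC.
  under eq_bigr do rewrite set_at_set.
  by rewrite addF2 add0r.
case: n yv => [|n] yv.
  have -> : Negz 0 + 1 = Posz 0 by [].
  by rewrite big_ord0 big_ord1 -yv set_at_id add0r.
have -> : Negz n.+1 + 1 = Negz n by rewrite !NegzE -[n.+2]addn1 PoszD opprD subrK.
rewrite [X in _ + X]big_ord_recr /= -yv set_at_id addrA.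
under eq_bigr do rewrite set_at_set.
by rewrite addF2 add0r.
Qed.

Lemma shift_invariant v f y k :
  (forall y, f (shift v y) =1 f y) -> f (set_at y v k) =1 f y.
Proof.
move=> fT t; have step l : f (set_at y v (l + 1)) t = f (set_at y v l) t.
  by rewrite -(fT (set_at y v l)) /shift set_at_same set_at_set.
have all0 l : f (set_at y v l) t = f (set_at y v 0) t.
  have succE n : Posz n.+1 = Posz n + 1 by rewrite -addn1.
  elim/int_rect: l => // n IHn; first by rewrite succE step.
  by rewrite -step succE opprD subrK.
by rewrite all0 -(all0 (y v)) set_at_id.
Qed.

(** The connecting map of the Wang sequence is multiplication by [x v]: the parity of the coordinate
    [v] times [C] is a preimage of [C] under translation minus identity, by [parity_shift], and its
    coboundary is computed here from [act_parity]. *)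
Lemma acobound_parity v (C : cocycle G) y t :
  acobound act (fun y t => (y v)%:~R * C t) y t = (x v * C) t.
Proof.
case: t => [|g t]; first by rewrite degree1M_nil.
rewrite [LHS]/= degree1M_cons // tail_facesZ act_parity mulrDl addrAC -mulrDr.
by rewrite -cobound_cons cocycle_cobound mulr0 add0r.
Qed.

Lemma comb_cons v s c t : comb (map x (v :: s)) c t =
  comb (map x s) (c \o cons false) t + (x v * comb (map x s) (c \o cons true)) t.
Proof. by []. Qed.

Section Step.
Variables (v : V) (s : seq V).
Hypothesis v_s : v \notin s.
Hypothesis act_agree : forall y y' g,
  agree_off s y y' -> agree_off s (act y g) (act y' g).
Hypothesis act_shift : forall y g,
  agree_off s (act (shift v y) g) (shift v (act y g)).

Lemma agree_set_at y y' k :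
  agree_off s y y' -> agree_off s (set_at y v k) (set_at y' v k).
Proof. by move=> yy' u us; rewrite /set_at; case: eqP => // _; apply: yy'. Qed.

Lemma depends_offD f h : depends_off s f -> depends_off s h ->
  depends_off s (fun y t => f y t + h y t).
Proof. by move=> df dh y y' yy' t; rewrite (df _ _ yy') (dh _ _ yy'). Qed.

Lemma depends_off_shift f :
  depends_off s f -> depends_off s (fun y => f (shift v y)).
Proof.
move=> df y y' yy'; apply: df; rewrite /shift (yy' _ v_s).
exact: agree_set_at.
Qed.

Lemma depends_off_primitive f :
  depends_off s f -> depends_off s (primitive v f).
Proof.
move=> df y y' yy' t; rewrite /primitive (yy' _ v_s).
by case: (y' v) => n; apply: eq_bigr => i _; apply: df; apply: agree_set_at.
Qed.

Lemma depends_off_acobound f :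
  depends_off s f -> depends_off s (acobound act f).
Proof.
move=> df y y' yy' [|g t] //=; congr (_ + _).
  by apply: df; apply: act_agree.
by apply: eq_tail_faces; apply: df.
Qed.

Lemma depends_off_parity (C : seq G -> 'F_2) :
  depends_off s (fun y t => (y v)%:~R * C t).
Proof. by move=> y y' yy' t; rewrite (yy' _ v_s). Qed.

Lemma depends_off_cons f : depends_off (v :: s) f -> depends_off s f.
Proof.
move=> df y y' yy'; apply: df => u.
by rewrite inE negb_or => /andP[_]; apply: yy'.
Qed.

Lemma depends_off_shift_invariant f :
  depends_off s f -> (forall y, f (shift v y) =1 f y) -> depends_off (v :: s) f.
Proof.
move=> df fT y y' yy' t; rewrite -(shift_invariant _ (y' v) fT).
apply: df => u us; rewrite /set_at; case: eqP => [->//|/eqP uv].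
by apply: yy'; rewrite inE negb_or uv.
Qed.

Lemma shift_depends_off_cons f : depends_off (v :: s) f ->
  forall y, f (shift v y) =1 f y.
Proof.
move=> df y; apply: df => u; rewrite inE negb_or => /andP[uv _].
by rewrite /shift /set_at (negbTE uv).
Qed.

Lemma acobound_shift f y t : depends_off s f ->
  acobound act (fun y => f (shift v y)) y t = acobound act f (shift v y) t.
Proof.
move=> df; case: t => [|g t] //=; congr (_ + _); apply: df => u us.
by rewrite act_shift.
Qed.

Lemma parity_shift y : (shift v y v)%:~R = (y v)%:~R + 1 :> 'F_2.
Proof. by rewrite /shift set_at_same rmorphD. Qed.

(* The variation of [h] along [v] is a cocycle; its expansion gives the
   coefficients of the multiples of [x v]. *)
Lemma cocycles_spanned_cons : cocycles_spanned s -> cocycles_spanned (v :: s).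
Proof.
move=> span_s f df fZ.
have [c [h [dh fE]]] := span_s _ (depends_off_cons df) fZ.
pose k y t := h (shift v y) t + h y t.
have dk : depends_off s k by apply: depends_offD => //; apply: depends_off_shift.
have [y t|e [p [dp kE]]] := span_s _ dk.
  rewrite acoboundD acobound_shift //.
  have hE z : acobound act h z t = f z t + comb (map x s) c t.
    by rewrite fE addrAC addF2 add0r.
  by rewrite !hE (shift_depends_off_cons df) addF2.
set C := comb _ e in kE; pose p' := primitive v p.
have dp' : depends_off s p' by apply: depends_off_primitive.
(* The two added terms lift the two terms of [kE] through translation minus identity, so [h'] is
   invariant under [shift v]. Only the first has a nontrivial coboundary, [x v * C]. *)
pose h' y t := h y t + ((y v)%:~R * C t + acobound act p' y t).
(* The first bit of the mask tells whether the factor [x v] occurs. *)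
exists (fun m => if m is b :: m' then if b then e m' else c m' else false).
exists h'; split.
  apply: depends_off_shift_invariant => [|y t].
    apply: depends_offD => //; apply: depends_offD.
      exact: depends_off_parity.
    exact: depends_off_acobound.
  apply/eqP; rewrite -subr_eq0 oppF2 /h' parity_shift; apply/eqP.
  rewrite -acobound_shift //.
  have -> : acobound act (fun y0 => p' (shift v y0)) y t =
      acobound act p y t + acobound act p' y t.
    rewrite -acoboundD; apply: eq_acobound => z u.
    by rewrite -(primitiveK v p) -/p' -addrA addF2 addr0.
  have -> : h (shift v y) t = C t + acobound act p y t + h y t.
    by rewrite -kE /k -addrA addF2 addr0.
  rewrite mulrDl mul1r; set a := C t; set b := acobound _ _ _ _.
  set d := acobound _ _ _ _; set g := h y t; set z := _ * a.
  transitivity ((a + a) + (b + b) + (d + d) + (g + g) + (z + z)); first by ring.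
  by rewrite !addF2.
move=> y t; rewrite /h' !acoboundD acobound_parity acoboundK // addr0.
rewrite fE comb_cons -/C.
change (comb [seq x i | i <- s] c t + acobound act h y t =
  comb [seq x i | i <- s] c t + (x v * C) t + (acobound act h y t + (x v * C) t)).
by rewrite addrACA addF2 addr0.
Qed.

(** Once the coordinate [v] is available, [x v * b] is exact, hence so is [a], and its coefficients
    vanish. Then [k] is a cocycle; applying translation minus identity to it gives [b], as [h] is
    invariant, while applying it to the expansion of [k] leaves only a coboundary. So [b] is exact
    and its coefficients vanish too. *)
Lemma products_free_cons :
  cocycles_spanned s -> products_free s -> products_free (v :: s).
Proof.
move=> span_s free_s c h dh cE.
have dhs := depends_off_cons dh.
set a := comb (map x s) (c \o cons false).
set b := comb (map x s) (c \o cons true).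
have abE y t : a t + (x v * b) t = acobound act h y t by rewrite -cE.
pose k y t := h y t + (y v)%:~R * b t.
have dk : depends_off s k by apply: depends_offD => //; apply: depends_off_parity.
have aE y t : a t = acobound act k y t.
  by rewrite acoboundD acobound_parity -abE -addrA addF2 addr0.
have c0 := free_s _ _ dk aE.
have a0 t : a t = 0 by rewrite /a comb_eq0 // => m; rewrite size_map; apply: c0.
have [y t|e [p [dp kE]]] := span_s _ dk; first by rewrite -aE a0.
have dq : depends_off s (fun y t => p (shift v y) t + p y t).
  by apply: depends_offD => //; apply: depends_off_shift.
have bE y t : b t = acobound act (fun y t => p (shift v y) t + p y t) y t.
  rewrite acoboundD acobound_shift //.
  have pE z : acobound act p z t = k z t + comb (map x s) e t.
    by rewrite kE addrAC addF2 add0r.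
  rewrite !pE /k (shift_depends_off_cons dh) parity_shift mulrDl mul1r.
  set a' := comb (map x s) e t; set g := h y t; set z := _ * b t.
  transitivity (b t + (g + g) + (z + z) + (a' + a')); last by ring.
  by rewrite !addF2 !addr0.
have c1 := free_s _ _ dq bE.
by case=> [//|[] m [sm]]; [exact: (c1 m sm) | exact: (c0 m sm)].
Qed.

End Step.

(** * The acyclic complex of functions of all coordinates *)

Section Base.
Variables (y0 : Y) (orbit_map : Y -> G).
Hypothesis orbit_map_act : forall y g, orbit_map (act y g) = (orbit_map y * g)%g.
Hypothesis act_orbit_map : forall y, act y0 (orbit_map y) = y.

Lemma cocycles_spanned_nil : cocycles_spanned [::].
Proof.
(* A contracting homotopy: prepend the element that carries the base point to [y]. What survives is
   the constant in degree 0, the coefficient of the empty product. *)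
move=> f _ fZ; pose h y t := f y0 (orbit_map y :: t).
exists (fun=> f y0 [::] == 1), h; split=> [y y' yy'|y t].
  by have -> : y = y' by apply: funext => u; apply: yy'.
have -> : comb [seq x i | i <- [::]] (fun=> f y0 [::] == 1) t =
    f y0 [::] * unit_fun t.
  rewrite /= cocycle_nat; congr (_ * _).
  by case: (F2P (f y0 [::])) => ->.
case: t => [|g t].
  have := fZ y0 [:: orbit_map y]; rewrite /= act_orbit_map => /addF2_eq0 ->.
  by rewrite /unit_fun mulr1 addr0.
have := fZ y0 (orbit_map y :: g :: t); rewrite /= act_orbit_map => /addF2_eq0 ->.
by rewrite /h orbit_map_act /unit_fun mulr0 add0r.
Qed.

Lemma products_free_nil : products_free [::].
Proof.
move=> c h _ cE [|//] _; have /= := cE y0 [::].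
by rewrite cocycle_nat mulr1; case: (c [::]) => // /eqP; rewrite oner_eq0.
Qed.

End Base.

(** * From functions on the orbit down to constant coefficients *)

Section AllCoordinates.
Variables (y0 : Y) (orbit_map : Y -> G) (w : V) (s : seq V).
Hypothesis orbit_map_act : forall y g, orbit_map (act y g) = (orbit_map y * g)%g.
Hypothesis act_orbit_map : forall y, act y0 (orbit_map y) = y.
Hypothesis act_agree : forall s y y' g, w \notin s ->
  agree_off s y y' -> agree_off s (act y g) (act y' g).
Hypothesis act_shift : forall v y g,
  v != w -> act (shift v y) g = shift v (act y g).
Hypothesis act_shift_w : forall y g, act (shift w y) g w = act y g w + 1.
Hypothesis uniq_ws : uniq (w :: s).
Hypothesis mem_ws : forall v, v \in w :: s.

(** The coordinate [w] is forgotten last. The translation along it is only known to commute with the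
    action on the coordinate [w] itself, which is the only one left once those in [s] are gone; the
    other translations commute with the action outright. *)
Lemma spanned_and_free : cocycles_spanned (w :: s) /\ products_free (w :: s).
Proof.
have [w_s uniq_s] : w \notin s /\ uniq s by apply/andP.
have [span_s free_s] : cocycles_spanned s /\ products_free s.
  suff gen r : w \notin r -> uniq r -> cocycles_spanned r /\ products_free r.
    exact: gen.
  elim: r => [|v s' IHs].
    by split; [apply: cocycles_spanned_nil | apply: products_free_nil].
  rewrite inE negb_or => /andP[wv w_s'] /andP[v_s uniq_s'].
  have [//|//|span_s free_s] := IHs.
  have agr y y' g : agree_off s' y y' -> agree_off s' (act y g) (act y' g).
    exact: act_agree.
  have shi y g : agree_off s' (act (shift v y) g) (shift v (act y g)).
    by rewrite act_shift 1?eq_sym.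
  split; first exact: cocycles_spanned_cons span_s.
  exact: products_free_cons free_s.
have shi y g : agree_off s (act (shift w y) g) (shift w (act y g)).
  move=> u u_s; move: (mem_ws u); rewrite inE (negbTE u_s) orbF => /eqP->.
  by rewrite act_shift_w /shift set_at_same.
have agr y y' g : agree_off s y y' -> agree_off s (act y g) (act y' g).
  exact: act_agree.
split; first exact: cocycles_spanned_cons span_s.
exact: products_free_cons free_s.
Qed.

Lemma cocycle_comb (z : cocycle G) : exists c (h : seq G -> 'F_2),
  forall t, z t = comb (map x (w :: s)) c t + cobound h t.
Proof.
have [y t|c [h [dh zE]]] := spanned_and_free.1 (fun=> z) (fun _ _ _ _ => erefl).
  by rewrite acobound_cst cocycle_cobound.
exists c, (h y0) => t; rewrite (zE y0) -(acobound_cst act _ y0); congr (_ + _).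
(* With every coordinate forgotten, [h] is constant in [y] and becomes an ordinary cochain, possibly
   unbounded. *)
have hy0 y : h y = h y0 by apply: funext; apply: dh => v; rewrite mem_ws.
by apply: eq_acobound => y u; rewrite hy0.
Qed.

Lemma comb_cobound c (h : seq G -> 'F_2) :
  (forall t, comb (map x (w :: s)) c t = cobound h t) ->
  forall m, size m = (size s).+1 -> c m = false.
Proof.
move=> cE; apply: (spanned_and_free.2 _ (fun=> h)) => // y t.
by rewrite cE acobound_cst.
Qed.

End AllCoordinates.

End Wang.

(** * Normal forms in the oriented RAAG *)

Section IntegerPowers.
Variable G : groupType.
Local Open Scope group_scope.
Implicit Types (x y : G) (z : int).

Definition zpow x z : G :=
  match z with Posz n => x ^+ n | Negz n => x^-1 ^+ n.+1 end.

Lemma zpowS x z : zpow x (z + 1)%R = zpow x z * x.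
Proof.
case: z => [n|n].
  have -> : (Posz n + 1)%R = Posz n.+1 by rewrite -addn1.
  exact: expgSr.
have -> : (Negz n + 1)%R = (- Posz n)%R.
  by rewrite NegzE -[n.+1]addn1 PoszD GRing.opprD GRing.subrK.
rewrite [zpow x (Negz n)]/zpow expgSr -mulgA mulVg mulg1.
by case: n => // n; rewrite -NegzE.
Qed.

Lemma zpowB x z : zpow x (z - 1)%R = zpow x z * x^-1.
Proof. by rewrite -[in RHS](GRing.subrK 1%R z) zpowS mulgK. Qed.

Lemma zpow_ind (P : int -> Prop) : P 0%R -> (forall z, P z -> P (z + 1)%R) ->
  (forall z, P z -> P (z - 1)%R) -> forall z, P z.
Proof.
move=> P0 PS PB; elim/int_rect => // n Pn.
  by rewrite -addn1 PoszD; apply: PS.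
by rewrite -addn1 PoszD GRing.opprD; apply: PB.
Qed.

Lemma commute_zpow x y z : commute x y -> commute x (zpow y z).
Proof. by move=> xy; case: z => n /=; apply: commuteX => //; apply: commuteV. Qed.

Definition flip (b : bool) x := if b then x^-1 else x.

Lemma flipK b : involutive (flip b).
Proof. by case: b => //= x; rewrite /flip invgK. Qed.

Lemma flip_addb b c x : flip (b (+) c) x = flip b (flip c x).
Proof. by case: b c => [] []; rewrite /flip /= ?invgK. Qed.

Lemma conj_flip b x y : flip b x ^ y = flip b (x ^ y).
Proof. by case: b; rewrite /flip ?conjVg. Qed.

Lemma zpow_sign x z (b : bool) : zpow x (z + (-1) ^+ b)%R = zpow x z * flip b x.
Proof. by case: b; rewrite ?zpowS ?zpowB. Qed.

Definition oddz z : bool := z%:~R == 1%R :> 'F_2.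

Lemma F2_eq1D (a b : 'F_2) : (a + b == 1)%R = (a == 1%R) (+) (b == 1%R).
Proof.
by case: (F2P a) => ->; case: (F2P b) => ->.
Qed.

Lemma oddzD z z' : oddz (z + z')%R = oddz z (+) oddz z'.
Proof. by rewrite /oddz rmorphD F2_eq1D. Qed.

Lemma oddz_sign (b : bool) : oddz ((-1) ^+ b)%R.
Proof. by case: b. Qed.

Lemma conj_zpow b x y z : x ^ y = flip b x -> x ^ zpow y z = flip (b && oddz z) x.
Proof.
move=> xy; have xyV : x ^ y^-1 = flip b x.
  by rewrite -[in LHS](flipK b x) conj_flip -xy conjgK.
elim/zpow_ind: z => [|z IHz|z IHz]; first by rewrite conjg1 andbF.
- rewrite zpowS conjgM IHz conj_flip xy -flip_addb oddzD.
  by congr flip; case: b {IHz xy xyV} => //=; rewrite addbC.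
rewrite zpowB conjgM IHz conj_flip xyV -flip_addb oddzD.
by congr flip; case: b {IHz xy xyV} => //=; rewrite addbC.
Qed.

End IntegerPowers.

(** * The action on exponent vectors and its simple transitivity *)

Section RaagAction.
Variables (L : specialGraph) (w : vertex L).
Hypothesis complete_L : complete L.
Hypothesis special_edge_target : forall e, e \in special_edges L -> e.2 = w.
Local Notation V := (vertex L).
Local Notation Y := (V -> int).
Local Notation G := (oriented_raag L).
Implicit Types (u v : V) (y : Y) (l : V * bool) (a b : word V) (g h : G).

Definition inverted v := (v, w) \in special_edges L.

Lemma edge_cases e : e \in arcs L ->
  (e \in normal_edges L) || (e \in special_edges L).
Proof. by rewrite -edges_cover inE. Qed.

Lemma special_not_normal e : e \in special_edges L -> e \notin normal_edges L.
Proof.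
move=> es; apply/negP => en; have := edges_disjoint L.
by rewrite disjoint_subset => /subsetP/(_ e en); rewrite inE es.
Qed.

Lemma arc_neq u v : (u, v) \in arcs L -> u != v.
Proof. by apply: contraTneq => ->; apply: arcs_irreflexive. Qed.

Lemma normal_not_inverted u v : (u, v) \in normal_edges L ->
  (inverted u && (v == w) = false) * (inverted v && (u == w) = false).
Proof.
have nN o t : (o, t) \in normal_edges L -> inverted o && (t == w) = false.
  move=> en; apply/negP => /andP[ia /eqP bw].
  by have := special_not_normal ia; rewrite -bw en.
by move=> en; rewrite !nN //; apply: normal_edge_sym.
Qed.

Lemma inverted_w : inverted w = false.
Proof.
apply/negbTE/negP => iw; have /negP := arcs_irreflexive w; apply.
by rewrite -edges_cover inE [X in _ || X]iw orbT.
Qed.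

(* The signed exponent vector of the normal form with the power of [w] written
   last: right multiplication by [v] changes the exponent of [v] by a sign
   which depends on the parity of the exponent of [w] if [w] inverts [v]. *)
Definition sign y v : bool := inverted v && oddz (y w).

Definition letter_act y l : Y :=
  set_at y l.1 (y l.1 + (-1) ^+ (l.2 (+) sign y l.1)).

Definition word_act := foldl letter_act.

Lemma sign_w y : sign y w = false.
Proof. by rewrite /sign inverted_w. Qed.

Lemma letter_actE y l u :
  letter_act y l u = y u + (u == l.1)%:R * (-1) ^+ (l.2 (+) sign y u).
Proof.
by rewrite /letter_act /set_at; case: eqP => [->|_]; rewrite ?mul1r // mul0r addr0.
Qed.

Lemma sign_letter_act y l u :
  sign (letter_act y l) u = sign y u (+) (inverted u && (l.1 == w)).
Proof.
rewrite /sign letter_actE oddzD [w == _]eq_sym.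
case: (inverted u) => //=; congr (_ (+) _).
by case: (l.1 == w); rewrite ?mul1r ?oddz_sign // mul0r.
Qed.

Lemma word_act_cat y a b : word_act y (a ++ b) = word_act (word_act y a) b.
Proof. exact: foldl_cat. Qed.

Lemma word_act_rcons y a l : word_act y (rcons a l) = letter_act (word_act y a) l.
Proof. by rewrite -cats1 word_act_cat. Qed.

Lemma letter_act_cancel y v c : letter_act (letter_act y (v, c)) (v, ~~ c) = y.
Proof.
apply: funext => u; rewrite !letter_actE sign_letter_act /=.
case: eqP => [->|_]; last by rewrite !mul0r !addr0.
have -> : inverted v && (v == w) = false.
  by case: (eqVneq v w) => [->|]; rewrite ?inverted_w ?andbF.
by rewrite addbF !mul1r addNb signrN addrK.
Qed.

(** For a normal edge neither end changes the sign of the other, so the letters cancel in pairs. For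
    a special edge the target is [w], and the two equal letters [o] act under opposite parities of
    the exponent of [w], hence with opposite signs. *)
Lemma word_act_relator y e : e \in arcs L -> word_act y (raag_word e) = y.
Proof.
case: e => o t et; apply: funext => u.
rewrite /= !letter_actE !sign_letter_act /=.
have ot := arc_neq et; have [/orP[en|es]] := (edge_cases et).
  have [ow tw] := normal_not_inverted en; rewrite en.
  case: (eqVneq u t) => [->|ut]; last case: (eqVneq u o) => [->|uo];
    rewrite ?(eq_sym t o) ?(negbTE ot) ?eqxx ?mul0r ?mul1r ?addr0 //.
  - by rewrite tw; case: (eqVneq t w) => [->|]; rewrite ?inverted_w ?andbF !addbF signrN addrK.
  by rewrite ow; case: (eqVneq o w) => [->|]; rewrite ?inverted_w ?andbF !addbF signrN addrK.
have tw : t = w by apply: special_edge_target es.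
have io : inverted o by rewrite /inverted -tw.
rewrite (negbTE (special_not_normal es)); move: ot io; rewrite {}tw => ow io.
case: (eqVneq u w) => [->|uw]; last case: (eqVneq u o) => [->|uo];
    rewrite ?(eq_sym w o) ?(negbTE ow) ?eqxx ?mul0r ?mul1r ?addr0 //.
  by rewrite inverted_w !addbF signrN addrK.
by rewrite io /= addbF addbK addbT signrN subrK.
Qed.

Lemma word_act_eq y a b : word_eq (@raag_relator L) a b ->
  word_act y a = word_act y b.
Proof.
move=> ab; elim: ab y => {a b} [a y|a b _ IH y|a b c _ IH _ IH' y|a a' b b' _ IH _ IH' y
  |v c y|_ [e he ->] y].
- by [].
- by rewrite IH.
- by rewrite IH IH'.
- by rewrite !word_act_cat IH IH'.
- exact: letter_act_cancel.
exact: word_act_relator.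
Qed.

Definition act y g : Y := word_act y (repr g).
Definition class a : G := \pi_(presented (@raag_relator L)) a.

Lemma act_class y a : act y (class a) = word_act y a.
Proof. exact/word_act_eq/word_eq_repr. Qed.

Lemma class_surj g : exists a, g = class a.
Proof. exact: presP. Qed.

Lemma classM a b : class (a ++ b) = (class a * class b)%g.
Proof. by rewrite -[RHS]/(pres_mul _ _) pres_mulE. Qed.

Lemma actM y g h : act (act y g) h = act y (g * h)%g.
Proof.
have [a ->] := class_surj g; have [b ->] := class_surj h.
by rewrite -classM !act_class word_act_cat.
Qed.

Lemma act1 y : act y 1%g = y.
Proof. exact: (act_class y [::]). Qed.

Definition origin : Y := fun=> 0.
Definition exponent v g : int := act origin g v.

Lemma actE_w y g : act y g w = y w + exponent w g.
Proof.
rewrite /exponent; have [a ->] := class_surj g; rewrite !act_class.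
elim/last_ind: a => [|a l IHa]; first by rewrite addr0.
by rewrite !word_act_rcons !letter_actE IHa !sign_w addrA.
Qed.

Lemma sign_act y g v :
  sign (act y g) v = sign y v (+) (inverted v && oddz (exponent w g)).
Proof. by rewrite /sign actE_w oddzD; case: inverted. Qed.

(** Parities of the exponent of [w] add up, so along a word the signs met from [y] and from the
    origin differ by the fixed factor given by [sign y v]. In particular each exponent is a crossed
    homomorphism, as [exponentM] records. *)
Lemma actE y g v : act y g v = y v + (-1) ^+ sign y v * exponent v g.
Proof.
rewrite /exponent; have [a ->] := class_surj g.
elim/last_ind: a => [|a l IHa]; first by rewrite !act_class mulr0 addr0.
move: IHa; rewrite !act_class !word_act_rcons !letter_actE => ->.
rewrite -!act_class !sign_act.
rewrite mulrDr addrA; congr (_ + _); rewrite mulrCA; congr (_ * _).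
have -> : sign origin v = false by rewrite /sign andbF.
by rewrite -signr_addb addFb addbCA.
Qed.

Lemma exponentM v g h : exponent v (g * h)%g =
  exponent v g + (-1) ^+ (inverted v && oddz (exponent w g)) * exponent v h.
Proof. by rewrite /exponent -actM actE. Qed.

Lemma act_agree (s : seq V) y y' g : w \notin s ->
  agree_off s y y' -> agree_off s (act y g) (act y' g).
Proof. by move=> w_s yy' u us; rewrite !actE /sign !yy'. Qed.

Lemma act_shift v y g : v != w -> act (shift v y) g = shift v (act y g).
Proof.
move=> vw; apply: funext => u; rewrite actE.
have -> : sign (shift v y) u = sign y u.
  by rewrite /sign /shift /set_at eq_sym (negbTE vw).
rewrite /shift /set_at; case: eqP => [->|_]; rewrite actE // addrAC //.
Qed.

Lemma act_shift_w y g : act (shift w y) g w = act y g w + 1.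
Proof. by rewrite !actE_w /shift set_at_same addrAC. Qed.

Definition gen v : G := class [:: (v, false)].

Lemma class_gen v c : class [:: (v, c)] = flip c (gen v).
Proof.
case: c => //; apply: (@mulgI _ (gen v)); rewrite mulgV -classM /=.
by apply/eqP/pres_eqP; apply: (@word_eq_cancel _ _ v false).
Qed.

Lemma act_gen y v c : act y (flip c (gen v)) = letter_act y (v, c).
Proof. by rewrite -class_gen act_class. Qed.

Lemma raag_relation o t : (o, t) \in arcs L ->
  (gen t * gen o * (gen t)^-1 * flip ((o, t) \in normal_edges L) (gen o) = 1)%g.
Proof.
move=> et; rewrite -[(gen t)^-1%g]/(flip true (gen t)) -!class_gen.
have -> : 1%g = class (raag_word (o, t)).
  by apply/esym/eqP/pres_eqP/word_eq_relator; exists (o, t).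
rewrite -[raag_word _]/([:: (t, false)] ++ [:: (o, false)] ++ [:: (t, true)] ++
  [:: (o, (o, t) \in normal_edges L)]).
by rewrite !classM !mulgA.
Qed.

Lemma normal_commute o t : (o, t) \in normal_edges L -> commute (gen t) (gen o).
Proof.
move=> en; have et : (o, t) \in arcs L by rewrite -edges_cover inE en.
have := raag_relation et; rewrite en => /(canRL (mulgVK _)); rewrite mul1g.
by move/(canRL (mulgVK _)).
Qed.

Lemma arc_normal o t : (o, t) \in arcs L -> t != w -> (o, t) \in normal_edges L.
Proof.
by move=> et; apply: contraNT => en; have := edge_cases et;
  rewrite (negbTE en) => /special_edge_target /= ->.
Qed.

Lemma gen_commute u v : u != w -> v != w -> commute (gen u) (gen v).
Proof.
move=> uw vw; have [->|uv] := eqVneq u v; first exact: commute_refl.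
have /orP[e|e] := complete_L uv; last by apply/normal_commute/arc_normal.
exact/commute_sym/normal_commute/arc_normal.
Qed.

Lemma conj_gen v : v != w -> (gen v ^ gen w)%g = flip (inverted v) (gen v).
Proof.
rewrite /flip => vw; case: ifPn => iv.
  have et : (v, w) \in arcs L by rewrite -edges_cover inE [X in _ || X]iv orbT.
  have := raag_relation et; rewrite (negbTE (special_not_normal iv)) => rel.
  have vE : (gen v = (gen v)^-1 ^ (gen w)^-1)%g.
    apply: (@mulgI _ (gen w * gen v * (gen w)^-1)%g); rewrite rel conjVg conjgE invgK.
    by rewrite mulgA mulgV.
  by rewrite [in LHS]vE conjgKV.
suff /commgP/conjg_fixP : commute (gen v) (gen w) by [].
have /orP[e|e] := complete_L vw; last exact/normal_commute/arc_normal.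
apply/commute_sym/normal_commute; have := edge_cases e.
by rewrite [X in _ || X](negbTE iv) orbF.
Qed.

Variable s : seq V.
Hypothesis uniq_ws : uniq (w :: s).
Hypothesis mem_ws : forall v, v \in w :: s.

(** The inverse of the orbit map of the origin: [normal_form_act] is its equivariance and
    [act_normal_form] says that the orbit is everything. *)
Definition normal_form y : G :=
  ((\prod_(v <- s) zpow (gen v) (y v)) * zpow (gen w) (y w))%g.

Lemma prod_zpow_set_at (r : seq V) y v (c : bool) : {in r, forall u, commute (gen v) (gen u)} ->
  uniq r -> v \in r ->
  (\prod_(u <- r) zpow (gen u) (set_at y v (y v + (-1) ^+ c)%R u) =
   (\prod_(u <- r) zpow (gen u) (y u)) * flip c (gen v))%g.
Proof.
elim: r => // u r IHr cv /= /andP[u_r uniq_r]; rewrite !big_cons.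
have cvr : {in r, forall u, commute (gen v) (gen u)}.
  by move=> a a_r; apply: cv; rewrite inE a_r orbT.
rewrite inE => /predU1P[vu|v_r].
  rewrite -vu set_at_same zpow_sign -!mulgA; congr (_ * _)%g.
  have -> : (\prod_(a <- r) zpow (gen a) (set_at y v (y v + (-1) ^+ c)%R a) =
             \prod_(a <- r) zpow (gen a) (y a))%g.
    apply: eq_big_seq => a a_r; rewrite /set_at ifN //.
    by apply: contraNneq u_r => av; rewrite -vu -av.
  have : commute (gen v) (\prod_(a <- r) zpow (gen a) (y a))%g.
    rewrite big_seq; apply: commute_prod => a a_r; exact/commute_zpow/cvr.
  move=> comm; rewrite /flip; case: ifP => // _.
  exact/commute_sym/commuteV/commute_sym.
rewrite IHr // mulgA /set_at ifN //.
by apply: contraNneq u_r => ->.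
Qed.

(** A generator [v] other than [w] is moved left across the power of [w], which inverts it exactly
    when [sign y v] holds, and is then absorbed into a product of commuting powers. *)
Lemma normal_form_gen y v : normal_form (act y (gen v)) = (normal_form y * gen v)%g.
Proof.
have [w_s uniq_s] : w \notin s /\ uniq s by apply/andP.
rewrite -[gen v]/(flip false (gen v)) act_gen /letter_act /normal_form /=.
have [->|vw] := eqVneq v w.
  rewrite sign_w set_at_same zpowS mulgA; congr (_ * _ * _)%g.
  apply: eq_big_seq => u u_s; rewrite /set_at ifN //.
  by apply: contraNneq w_s => <-.
have v_s : v \in s by have := mem_ws v; rewrite inE (negbTE vw).
rewrite [X in zpow (gen w) X]/set_at eq_sym (negbTE vw) prod_zpow_set_at //; last first.
  move=> u u_s; apply: gen_commute => //.
  by apply: contraNneq w_s => <-.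
rewrite -!mulgA; congr (_ * _)%g; apply/eqP; rewrite conjgC.
rewrite conj_flip (conj_zpow _ (conj_gen vw)) -/(sign y v) flipK //.
Qed.

Lemma normal_form_act y g : normal_form (act y g) = (normal_form y * g)%g.
Proof.
(* Inverse letters reduce to positive ones because [act] is a group action. *)
have inv z v : normal_form (act z (gen v)^-1%g) = (normal_form z * (gen v)^-1)%g.
  apply: (@mulIg _ (gen v)); rewrite mulgVK -normal_form_gen actM mulVg act1 //.
have [a ->] := class_surj g; elim/last_ind: a => [|a [v c] IHa].
  by rewrite act1 mulg1.
rewrite -cats1 classM -actM class_gen mulgA -IHa.
by case: c; [apply: inv | apply: normal_form_gen].
Qed.

(** The condition on [y w] rules out signs. It holds throughout the first factor of a normal form,
    where the power of [w] has not yet acted. *)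
Lemma act_zpow y v z : v != w -> y w = 0 ->
  act y (zpow (gen v) z) = set_at y v (y v + z).
Proof.
move=> vw yw0; elim/zpow_ind: z => [|z IHz|z IHz].
- by rewrite act1 addr0 set_at_id.
- rewrite zpowS -actM IHz -[gen v]/(flip false (gen v)) act_gen /letter_act /=.
  rewrite set_at_same set_at_set /sign /set_at eq_sym (negbTE vw) yw0 andbF.
  by rewrite expr0 addrA.
rewrite zpowB -actM IHz -[(gen v)^-1%g]/(flip true (gen v)) act_gen /letter_act /=.
rewrite set_at_same set_at_set /sign /set_at eq_sym (negbTE vw) yw0 andbF.
by rewrite expr1 addrA.
Qed.

Lemma act_zpow_w y z : act y (zpow (gen w) z) = set_at y w (y w + z).
Proof.
elim/zpow_ind: z => [|z IHz|z IHz].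
- by rewrite act1 addr0 set_at_id.
- rewrite zpowS -actM IHz -[gen w]/(flip false (gen w)) act_gen /letter_act /=.
  by rewrite set_at_same set_at_set sign_w addrA.
rewrite zpowB -actM IHz -[(gen w)^-1%g]/(flip true (gen w)) act_gen /letter_act /=.
by rewrite set_at_same set_at_set sign_w addrA.
Qed.

Lemma act_prod_zpow (r : seq V) y z : w \notin r -> uniq r -> z w = 0 ->
  act z (\prod_(u <- r) zpow (gen u) (y u))%g =
  (fun u => if u \in r then z u + y u else z u).
Proof.
elim: r z => [|v r IHr] z; first by rewrite big_nil act1.
rewrite inE negb_or /= => /andP[wv w_r] /andP[v_r uniq_r] zw.
rewrite big_cons -actM act_zpow 1?eq_sym // IHr //; last first.
  by rewrite /set_at (negbTE wv).
apply: funext => u; rewrite inE /set_at; case: eqP => [->|//].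
by rewrite (negbTE v_r).
Qed.

Lemma act_normal_form y : act origin (normal_form y) = y.
Proof.
have [w_s uniq_s] : w \notin s /\ uniq s by apply/andP.
rewrite -actM act_prod_zpow // act_zpow_w; apply: funext => u.
rewrite /set_at (negbTE w_s) add0r; case: eqP => [->|/eqP uw] //.
by have := mem_ws u; rewrite inE (negbTE uw) /= => ->; rewrite add0r.
Qed.

End RaagAction.

(** * The cohomology ring *)

Lemma comb_addb (Q : pzRingType) (ts : seq Q) c e : 1 + 1 = 0 :> Q ->
  comb ts c + comb ts e = comb ts (fun m => c m (+) e m).
Proof.
move=> two0; elim: ts c e => [|t ts IHts] c e /=.
  by case: (c _) (e _) => [] []; rewrite ?addr0 ?add0r.
by rewrite addrACA -mulrDr !IHts.
Qed.

(** * Degrees of cochains and of cohomology classes *)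

Section Degrees.
Variable G : groupType.
Implicit Types (f : seq G -> 'F_2) (t : seq G) (z : cocycle G).

Lemma eq_tail_faces_size f f' g t :
  (forall t', size t' = size t -> f t' = f' t') ->
  tail_faces f g t = tail_faces f' g t.
Proof.
elim: t f f' g => [|h t IHt] f f' g ff' /=; first exact: ff'.
rewrite ff' //; congr (_ + _); apply: IHt => t' st'.
by apply: ff'; rewrite /= st'.
Qed.

Lemma eq_cobound_size f f' t :
  (forall t', (size t').+1 = size t -> f t' = f' t') -> cobound f t = cobound f' t.
Proof.
case: t => [//|g t] ff'; rewrite !cobound_cons ff' //; congr (_ + _).
by apply: eq_tail_faces_size => t' st'; apply: ff'; rewrite st'.
Qed.

Lemma cobound_fun0 t : cobound (fun=> 0) t = 0.
Proof. by case: t => // g t; rewrite /cobound big1. Qed.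

Definition deg1_fun (k : G -> 'F_2) t : 'F_2 := if t is [:: g] then k g else 0.

Lemma deg1_bounded k : bounded (deg1_fun k).
Proof. by exists 2 => -[|g []]. Qed.

Definition deg1_cochain k : cochain G := Cochain (introT (asboolP _) (deg1_bounded k)).

Lemma cobound_deg1 k t : cobound (deg1_fun k) t =
  if t is [:: g; h] then k g + k h + k (g * h)%g else 0.
Proof.
case: t => [//|g [|h [|i t]]]; rewrite cobound_cons.
- exact: addF2.
- by rewrite /=; ring.
rewrite (@eq_tail_faces_size _ (fun=> 0)); last by case=> [|? [|? ?]].
by rewrite add0r -tail_facesE big1.
Qed.

Lemma hom_cocycleP k : (forall g h, k (g * h)%g = k g + k h) ->
  deg1_cochain k \in @is_cocycle G.
Proof.
move=> kM; apply/asboolP => t; rewrite [LHS]cobound_deg1.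
by case: t => [|g [|h []]] //; rewrite kM addF2.
Qed.

Lemma deg1M z z' t : degree1 z -> degree1 z' ->
  (z * z') t = if t is [:: g; h] then z [:: g] * z' [:: h] else 0.
Proof.
move=> z1 z'1; case: t => [|g t]; first by rewrite degree1M_nil.
by rewrite degree1M_cons //; case: t => [|h []] *; rewrite // z'1 ?mulr0.
Qed.

Lemma coclass_zmod_morphism : zmod_morphism (@coclass G).
Proof. by move=> y z; rewrite /coclass !piE. Qed.

Lemma coclass_monoid_morphism : monoid_morphism (@coclass G).
Proof.
split; first by [].
by move=> y z; rewrite -cohom_mulE.
Qed.

HB.instance Definition _ := GRing.isZmodMorphism.Build (cocycle G) (cohomology G)
  (@coclass G) coclass_zmod_morphism.
HB.instance Definition _ := GRing.isMonoidMorphism.Build (cocycle G) (cohomology G)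
  (@coclass G) coclass_monoid_morphism.

Lemma coclass_eqP y z : coclass y = coclass z <->
  exists c : cochain G, forall t, y t + z t = cobound c t.
Proof.
rewrite coclass_eq; split=> [/asboolP[c yz]|[c yz]]; first by exists c.
by apply/asboolP; exists c.
Qed.

Lemma cohomology_two0 : 1 + 1 = 0 :> cohomology G.
Proof.
rewrite -[1](rmorph1 (@coclass G)) -rmorphD -[RHS](rmorph0 (@coclass G)).
by apply/coclass_eqP; exists 0 => t; rewrite cobound0 addr0; exact: addF2.
Qed.

Lemma cohomology_oner_neq0 : 1 != 0 :> cohomology G.
Proof.
apply/eqP; rewrite -[1](rmorph1 (@coclass G)) -[RHS](rmorph0 (@coclass G)).
move=> /coclass_eqP[c] /(_ [::]) /eqP; rewrite addr0 cocycle1.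
by rewrite /unit_fun /= oner_eq0.
Qed.

Lemma cohomology_degD d (X X' : cohomology G) :
  cohomology_deg d X -> cohomology_deg d X' -> cohomology_deg d (X + X').
Proof.
move=> [z zd ->] [z' zd' ->]; exists (z + z'); last by rewrite rmorphD.
by move=> t dt; rewrite cocycleD zd // zd' // addr0.
Qed.

Lemma cohomology_degM d d' (X X' : cohomology G) :
  cohomology_deg d X -> cohomology_deg d' X' -> cohomology_deg (d + d') (X * X').
Proof.
move=> [z zd ->] [z' zd' ->]; exists (z * z'); last by rewrite rmorphM.
move=> t dt; rewrite cocycleM /cup big1 // => i _.
have [it|it] := eqVneq (size (take i t)) d; last by rewrite zd ?mul0r.
rewrite zd' ?mulr0 //; apply: contraNneq dt => <-.
by rewrite -it -size_cat cat_take_drop.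
Qed.

Lemma cohomology_deg0 d : cohomology_deg d (0 : cohomology G).
Proof. by exists 0; rewrite ?rmorph0. Qed.

Lemma cohomology_deg1 : cohomology_deg 0 (1 : cohomology G).
Proof.
exists 1; last by rewrite rmorph1.
by move=> t; rewrite size_eq0 cocycle1 /unit_fun => /negbTE ->.
Qed.

(** * The basis of squarefree products and its compatibility with the grading *)

Section Basis.
Variables (V : eqType) (x : V -> cocycle G) (s : seq V).
Hypothesis x1 : forall v, degree1 (x v).
Hypothesis spanned : forall z : cocycle G, exists c (h : seq G -> 'F_2),
  forall t, z t = comb (map x s) c t + cobound h t.
Hypothesis free : forall c (h : seq G -> 'F_2),
  (forall t, comb (map x s) c t = cobound h t) ->
  forall m, size m = size s -> c m = false.

(** The product selected by a mask is homogeneous of degree the weight of the mask, so a sequence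
    [t] only sees the masks of weight [size t]. *)
Lemma eq_comb_degree c e t :
  (forall m, size m = size s -> count id m = size t -> c m = e m) ->
  comb (map x s) c t = comb (map x s) e t.
Proof.
elim: (s) c e t => [|v r IHr] c e t ce.
  rewrite /= !cocycle_nat /unit_fun; case: t ce => [|g t] ce; last by rewrite !mulr0.
  by rewrite ce.
rewrite !comb_cons; congr (_ + _).
  by apply: IHr => m sm ct; apply: ce; rewrite /= ?sm.
case: t ce => [|g t] ce; first by rewrite !degree1M_nil.
rewrite !degree1M_cons //; congr (_ * _); apply: IHr => m sm ct.
by apply: ce; rewrite /= ?sm ?ct.
Qed.

Lemma comb_high c t : (size s < size t)%N -> comb (map x s) c t = 0.
Proof.
move=> st; rewrite (@eq_comb_degree _ (fun=> false)) ?comb_eq0 // => m sm ct.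
by have := count_size id m; rewrite sm ct leqNgt st.
Qed.

Let xi v := coclass (x v).

Lemma coclass_comb c : coclass (comb (map x s) c) = comb (map xi s) c.
Proof. by rewrite combM -map_comp. Qed.

Lemma cohomology_spanned (X : cohomology G) : exists c, X = comb (map xi s) c.
Proof.
have [z ->] := coclassP X; have [c [h zE]] := spanned z.
have [N zN] := cochain_boundedP z.
(* The cochain [h] may be unbounded, so it is truncated to sizes below [M]. On sequences longer than
   [M] both [z] and the combination vanish, and so does the coboundary of the truncation. *)
pose M := maxn N (size s).+1; exists c; rewrite -coclass_comb.
pose h' t := if (size t < M)%N then h t else 0.
have h'_bounded : bounded h' by exists M => t; rewrite /h' ltnNge => ->.
apply/coclass_eqP; exists (Cochain (introT (asboolP _) h'_bounded)) => t.
rewrite [RHS](_ : _ = cobound h' t) //.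
have [tM|Mt] := leqP (size t) M.
  rewrite zE addrAC addF2 add0r; apply: eq_cobound_size => t' st'.
  by rewrite /h' st' tM.
rewrite zN ?comb_high ?addr0; last 2 first.
- by apply: leq_trans (ltnW Mt); rewrite leq_max leqnn orbT.
- by apply: leq_trans (ltnW Mt); rewrite leq_max leqnn.
rewrite (@eq_cobound_size _ (fun=> 0)) ?cobound_fun0 // => t' st'.
by rewrite /h' st' leqNgt Mt.
Qed.

Lemma cohomology_free c : comb (map xi s) c = 0 ->
  forall m, size m = size s -> c m = false.
Proof.
rewrite -coclass_comb -[RHS](rmorph0 (@coclass G)) => /coclass_eqP[h cE].
by apply: (@free _ h) => t; rewrite -cE addr0.
Qed.

(** A homogeneous representative has an expansion with masks of weight [d] only; by freeness it is
    the given one. *)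
Lemma cohomology_deg_comb d c : cohomology_deg d (comb (map xi s) c) ->
  forall m, size m = size s -> count id m != d -> c m = false.
Proof.
move=> [z zd cz] m sm md; have [e [h zE]] := spanned z.
pose e' m := e m && (count id m == d).
(* The part of [h] of degree [d - 1], which is zero for [d = 0]. *)
pose h' t := if (size t).+1 == d then h t else 0.
have zE' t : z t = comb (map x s) e' t + cobound h' t.
  have [td|td] := eqVneq (size t) d; last first.
    rewrite zd // (@eq_comb_degree e' (fun=> false)) ?comb_eq0 //; last first.
      by move=> m' _ ct; rewrite /e' ct (negbTE td) andbF.
    rewrite (@eq_cobound_size h' (fun=> 0)) ?cobound_fun0 ?addr0 // => t' st'.
    by rewrite /h' st' (negbTE td).
  rewrite zE; congr (_ + _).
    by apply: eq_comb_degree => m' _ ct; rewrite /e' ct td eqxx andbT.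
  by apply: eq_cobound_size => t' st'; rewrite /h' st' td eqxx.
move: cz; rewrite -coclass_comb => /coclass_eqP[b cz].
have two0 : 1 + 1 = 0 :> cohomology G by exact: cohomology_two0.
have ce : comb (map xi s) (fun m => c m (+) e' m) = 0.
  rewrite -comb_addb // -!coclass_comb -rmorphD -[RHS](rmorph0 (@coclass G)).
  apply/coclass_eqP.
  have bh : bounded (fun t => b t + h' t).
    have [N bN] := cochain_boundedP b; exists (maxn N d) => t.
    rewrite geq_max => /andP[Nt dt]; rewrite bN // add0r /h'.
    by rewrite gtn_eqF // ltnS.
  exists (Cochain (introT (asboolP _) bh)) => t.
  rewrite addr0 cocycleD [RHS](_ : _ = cobound (fun t => b t + h' t) t) //.
  have -> : cobound (fun t => b t + h' t) t = cobound b t + cobound h' t.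
    by case: t => [|g t]; rewrite ?addr0 // !cobound_cons tail_facesD addrACA.
  by rewrite -cz zE' -!addrA addF2 addr0.
have := cohomology_free ce sm; rewrite /e' (negbTE md) andbF addbF; exact.
Qed.

End Basis.
End Degrees.

(** * Presentation of the target *)

Section Span.
Variable Q : pzRingType.
Hypothesis two0 : 1 + 1 = 0 :> Q.
Implicit Types (t u y z : Q) (ts us : seq Q).

Definition in_span ts y := exists c, y = comb ts c.

Lemma in_span_cons t ts y : in_span (t :: ts) y <->
  exists y0 y1, [/\ in_span ts y0, in_span ts y1 & y = y0 + t * y1].
Proof.
split=> [[c ->]|[_ [_ [[c ->] [e ->] ->]]]].
  exists (comb ts (c \o cons false)), (comb ts (c \o cons true)).
  by split=> //; eexists.
by exists (fun m => if m is b :: m' then if b then e m' else c m' else false).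
Qed.

Lemma in_spanD ts y z : in_span ts y -> in_span ts z -> in_span ts (y + z).
Proof. by move=> [c ->] [e ->]; rewrite comb_addb //; eexists. Qed.

Lemma in_span0 ts : in_span ts 0.
Proof. by exists (fun=> false); rewrite comb_eq0. Qed.

Lemma in_span1 ts : in_span ts 1.
Proof.
elim: ts => [|t ts IHts]; first by exists (fun=> true).
by apply/in_span_cons; exists 1, 0; rewrite mulr0 addr0; split=> //; apply: in_span0.
Qed.

(** A squarefree product contains [u] at most once, so multiplying it by [u] creates at most one
    square, which is replaced by 0 or by a single new factor [t]. *)
Lemma in_span_mul_tail t us u y :
  {in us &, forall a b, GRing.comm a b} ->
  {in us, forall a, a * a = 0 \/ a * a = t * a} ->
  {in us, forall a, GRing.comm a t} ->
  u \in us -> in_span us y ->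
  exists y0 y1, [/\ in_span us y0, in_span us y1 & u * y = y0 + t * y1].
Proof.
elim: us y => // a us IHus y comm sq commt.
have sub b : b \in us -> b \in a :: us by rewrite inE orbC => ->.
rewrite inE => /orP[/eqP->|u_us] /in_span_cons[y0 [y1 [sy0 sy1 ->]]].
  have [aa|aa] := sq a (mem_head _ _).
    exists (a * y0), 0; rewrite mulrDr mulrA aa mul0r mulr0; split=> //.
      apply/in_span_cons; exists 0, y0; rewrite add0r; split=> //; exact: in_span0.
    exact: in_span0.
  exists (a * y0), (a * y1); rewrite mulrDr !mulrA aa -mulrA; split=> //;
    apply/in_span_cons; [exists 0, y0|exists 0, y1]; rewrite add0r; split=> //;
    exact: in_span0.
have IH := IHus _ _ _ _ u_us; case: (IH y0) => // [b c bu cu|b bu|b bu|p [q [sp sq' Ep]]].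
- by apply: comm; apply: sub.
- by apply: sq; apply: sub.
- by apply: commt; apply: sub.
case: (IH y1) => // [b c bu cu|b bu|b bu|p' [q' [sp' sq'' Ep']]].
- by apply: comm; apply: sub.
- by apply: sq; apply: sub.
- by apply: commt; apply: sub.
exists (p + a * p'), (q + a * q'); split.
- by apply/in_span_cons; exists p, p'.
- by apply/in_span_cons; exists q, q'.
have ua : u * a = a * u by apply: comm; rewrite ?mem_head ?sub.
have at_ : a * t = t * a by apply: commt; rewrite mem_head.
by rewrite mulrDr mulrA ua -mulrA Ep Ep' !mulrDr !mulrA at_ addrACA.
Qed.

Section Relations.
Variables (t : Q) (us : seq Q).
Hypothesis comm_ts : {in t :: us &, forall a b, GRing.comm a b}.
Hypothesis t_sq : t * t = 0.
Hypothesis us_sq : {in us, forall a, a * a = 0 \/ a * a = t * a}.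

Lemma in_span_mul u y : u \in t :: us ->
  in_span (t :: us) y -> in_span (t :: us) (u * y).
Proof.
have sub b : b \in us -> b \in t :: us by rewrite inE orbC => ->.
rewrite inE => /orP[/eqP->|u_us] /in_span_cons[y0 [y1 [sy0 sy1 ->]]].
  rewrite mulrDr mulrA t_sq mul0r addr0; apply/in_span_cons.
  by exists 0, y0; rewrite add0r; split=> //; apply: in_span0.
have comm_us : {in us &, forall a b, GRing.comm a b}.
  by move=> a b au bu; apply: comm_ts; apply: sub.
have comm_t : {in us, forall a, GRing.comm a t}.
  by move=> a au; apply: comm_ts; rewrite ?mem_head // sub.
have [p [q [sp sq Ep]]] := in_span_mul_tail comm_us us_sq comm_t u_us sy0.
have [p' [q' [sp' sq' Ep']]] := in_span_mul_tail comm_us us_sq comm_t u_us sy1.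
(* The remaining term contains [t * t] and vanishes. *)
apply/in_span_cons; exists p, (q + p'); split=> //; first exact: in_spanD.
rewrite mulrDr mulrA (comm_t u) // -mulrA Ep Ep' mulrDr.
by rewrite [t * (t * _)]mulrA t_sq mul0r addr0 mulrDr addrA.
Qed.

End Relations.
End Span.

Section GradedComb.
Variables (Q : pzRingType) (deg : nat -> Q -> Prop).
Hypothesis deg0 : forall d, deg d 0.
Hypothesis deg1 : deg 0 1.
Hypothesis degD : forall d y z, deg d y -> deg d z -> deg d (y + z).
Hypothesis degM : forall d e y z, deg d y -> deg e z -> deg (d + e) (y * z).

Lemma deg_comb (ts : seq Q) c d : {in ts, forall t, deg 1 t} ->
  (forall m, size m = size ts -> count id m != d -> c m = false) ->
  deg d (comb ts c).
Proof.
elim: ts c d => [|t ts IHts] c d ts1 cd /=.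
  case: (d =P 0%N) => [->|/eqP d0]; first by case: (c _).
  by rewrite cd // eq_sym.
have ts1' : {in ts, forall t, deg 1 t}.
  by move=> u u_ts; apply: ts1; rewrite inE u_ts orbT.
apply: degD; first by apply: IHts => // m sm md; apply: cd; rewrite /= ?sm.
case: d cd => [|d] cd.
  by rewrite [comb _ _]comb_eq0 ?mulr0 // => m sm; apply: cd; rewrite //= sm.
rewrite -add1n; apply: degM; first by apply: ts1; rewrite mem_head.
by apply: IHts => // m sm md; apply: cd; rewrite /= ?sm.
Qed.

End GradedComb.

(** * Universal properties of polynomial rings, quotients and tensor products *)

Section MpolyF2.
Variable n : nat.

Lemma mpolyF2_ind (K : {mpoly 'F_2[n]} -> Prop) :
  K 0 -> K 1 -> (forall p q, K p -> K q -> K (p + q)) ->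
  (forall p q, K p -> K q -> K (p * q)) -> (forall i, K 'X_i) -> forall p, K p.
Proof.
move=> K0 K1 KD KM KX p; rewrite [p]mpolyE.
apply: (big_ind K) => // m _; have [->|->] := F2P p@_m; rewrite ?scale0r // scale1r.
rewrite mpolyXE_id; apply: (big_ind K) => // i _.
by elim: (m i) => [|k IHk]; rewrite ?expr0 // exprS; apply: KM.
Qed.

End MpolyF2.

Section F2Algebra.
Variable Q : comNzRingType.
Hypothesis two0 : 1 + 1 = 0 :> Q.

(** The structure map of [Q] as an algebra over the field with two elements, recovered from
    [1 + 1 = 0] alone. *)
Definition F2_in (c : 'F_2) : Q := (c : nat)%:R.

Lemma F2_in_zmod_morphism : zmod_morphism F2_in.
Proof.
have opp1 : - 1 = 1 :> Q by apply/eqP; rewrite eq_sym -subr_eq0 opprK two0.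
move=> a b; have [->|->] := F2P a; have [->|->] := F2P b; rewrite /F2_in /=.
all: by rewrite ?subr0 ?subrr ?sub0r ?opp1.
Qed.

Lemma F2_in_monoid_morphism : monoid_morphism F2_in.
Proof.
split=> // a b; have [->|->] := F2P a; have [->|->] := F2P b.
all: by rewrite /F2_in /= ?(mul0r, mulr0, mulr1).
Qed.

Lemma mpoly_eval n (h : 'I_n -> Q) :
  exists f : {rmorphism {mpoly 'F_2[n]} -> Q}, forall i, f 'X_i = h i.
Proof.
pose fZ := GRing.isZmodMorphism.Build 'F_2 Q F2_in F2_in_zmod_morphism.
pose fM := GRing.isMonoidMorphism.Build 'F_2 Q F2_in F2_in_monoid_morphism.
pose f : {rmorphism 'F_2 -> Q} := HB.pack F2_in fZ fM.
exists (mmap f h) => i; exact: etrans (mmapX _ _ _) (mmap1U _ _).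
Qed.

Lemma quot_lift (R : comNzRingType) (I : idealr R) (f : {rmorphism R -> Q}) :
  (forall p, p \in (I : {pred R}) -> f p = 0) ->
  exists g : {rmorphism Quotient.quot I -> Q}, forall p, g (\pi p) = f p.
Proof.
move=> fI; pose g (a : Quotient.quot I) := f (repr a).
have gE p : g (\pi p) = f p.
  apply/eqP; rewrite -subr_eq0 -rmorphB fI //.
  by rewrite Quotient.idealrBE reprK.
have repE (a : Quotient.quot I) : exists p, a = \pi p by exists (repr a); rewrite reprK.
have gB : zmod_morphism g.
  move=> a b; have [p ->] := repE a; have [q ->] := repE b.
  by rewrite -rmorphB !gE rmorphB.
have gM : monoid_morphism g.
  split=> [|a b]; first by rewrite -(rmorph1 (\pi_(Quotient.quot I))) gE rmorph1.
  have [p ->] := repE a; have [q ->] := repE b.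
  by rewrite -rmorphM !gE rmorphM.
pose gZ := GRing.isZmodMorphism.Build _ _ g gB.
pose gM' := GRing.isMonoidMorphism.Build _ _ g gM.
pose g' : {rmorphism Quotient.quot I -> Q} := HB.pack g gZ gM'.
by exists g'.
Qed.

(** Ring morphisms respect scalars here, a scalar being 0 or 1, so the pairing is balanced; it is
    multiplicative because [Q] is commutative. *)
Lemma tensor_lift (A B : algType 'F_2)
    (f : {rmorphism A -> Q}) (g : {rmorphism B -> Q}) :
  exists h : {rmorphism tensor A B -> Q},
    forall s, h (tclass s) = \sum_(p <- s) f p.1 * g p.2.
Proof.
pose v (s : seq (A * B)) := \sum_(p <- s) f p.1 * g p.2.
have v_eq s t : tensor_eq s t -> v s = v t.
  elim=> {s t} // [s t u _ -> _ ->//|s s' t t' _ ss' _ tt'|p q|b|a a' b|a b b'|c a b].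
  - by rewrite /v !big_cat; congr (_ + _).
  - by rewrite /v !big_cons !big_nil !addr0 addrC.
  - by rewrite /v big_seq1 big_nil /= rmorph0 mul0r.
  - by rewrite /v !big_cons !big_nil /= !addr0 rmorphD mulrDl.
  - by rewrite /v !big_cons !big_nil /= !addr0 rmorphD mulrDr.
  rewrite /v !big_seq1 /=; have [->|->] := F2P c; rewrite ?scale1r //.
  by rewrite !scale0r !rmorph0 mul0r mulr0.
pose h (a : tensor A B) := v (repr a).
have hE s : h (tclass s) = v s by apply: v_eq; apply: tensor_eq_repr.
have hD : nmod_morphism h.
  split=> [|a b]; first by rewrite -[0]/(tclass [::]) hE /v big_nil.
  have [s ->] := tclassP a; have [t ->] := tclassP b.
  by rewrite -[_ + _ in LHS]/(tensor_add _ _) tensor_addE !hE /v big_cat.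
have hM : monoid_morphism h.
  split=> [|a b].
    by rewrite -[1]/(tclass [:: (1, 1)]) hE /v big_seq1 !rmorph1 mulr1.
  have [s ->] := tclassP a; have [t ->] := tclassP b.
  rewrite -[_ * _ in LHS]/(tensor_mul _ _) tensor_mulE !hE /v.
  rewrite big_allpairs_dep mulr_suml; apply: eq_bigr => p _.
  rewrite mulr_sumr; apply: eq_bigr => q _ /=.
  by rewrite !rmorphM mulrACA.
pose hZ := GRing.isNmodMorphism.Build _ _ h hD.
pose hM' := GRing.isMonoidMorphism.Build _ _ h hM.
pose h' : {rmorphism tensor A B -> Q} := HB.pack h hZ hM'.
by exists h'.
Qed.

End F2Algebra.

Lemma opp_lmodF2 (A : lmodType 'F_2) (a : A) : - a = a.
Proof. by rewrite -scaleN1r oppF2 scale1r. Qed.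

Lemma mem_ideal_span (R : comNzRingType) (s : seq R) p : p \in s -> p \in ideal_span s.
Proof.
move=> ps; have lt_p : (index p s < size s)%N by rewrite index_mem.
apply/asboolP; exists (fun i => (i == index p s)%:R).
rewrite (bigD1 (Ordinal lt_p)) //= eqxx mul1r nth_index // big1 ?addr0 //.
by move=> i; rewrite -val_eqE /= => /negbTE ->; rewrite mul0r.
Qed.

Lemma ideal_span_ker (R : comNzRingType) (Q : comNzRingType) (s : seq R)
  (f : {rmorphism R -> Q}) p :
  {in s, forall a, f a = 0} -> p \in ideal_span s -> f p = 0.
Proof.
move=> fs /asboolP[c ->]; rewrite rmorph_sum big1 // => i _.
by rewrite rmorphM /= [X in _ * X]fs ?mulr0 // mem_nth.
Qed.

(** * Spanning and grading of the target ring *)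

Section Target.
Variables r m : nat.
Local Notation A := (RV_algebra r).
Local Notation B := (W_algebra m).
Local Notation T := (target r m).

Definition inA (a : A) : T := tclass [:: (a, 1)].
Definition inB (b : B) : T := tclass [:: (1, b)].

Lemma target_two0 : 1 + 1 = 0 :> T.
Proof.
rewrite -[_ + _]/(tensor_add _ _) tensor_addE; apply/tclass_eq.
apply: (@tensor_eq_trans _ _ _ _ [:: (1 + 1, 1)]).
  exact/tensor_eq_sym/tensor_eq_Dl.
by rewrite -[X in X + _]opp_lmodF2 addNr; exact: tensor_eq_0l.
Qed.

Lemma inA0 : inA 0 = 0.
Proof. by apply/tclass_eq; exact: tensor_eq_0l. Qed.

Lemma inAD a a' : inA (a + a') = inA a + inA a'.
Proof.
by rewrite -[RHS]/(tensor_add _ _) tensor_addE; apply/tclass_eq; exact: tensor_eq_Dl.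
Qed.

Lemma inAM a a' : inA (a * a') = inA a * inA a'.
Proof. by rewrite -[RHS]/(tensor_mul _ _) tensor_mulE /seq_mul /= mulr1. Qed.

Lemma inBD b b' : inB (b + b') = inB b + inB b'.
Proof.
by rewrite -[RHS]/(tensor_add _ _) tensor_addE; apply/tclass_eq; exact: tensor_eq_Dr.
Qed.

Lemma inBM b b' : inB (b * b') = inB b * inB b'.
Proof. by rewrite -[RHS]/(tensor_mul _ _) tensor_mulE /seq_mul /= mulr1. Qed.

Lemma inB0 : inB 0 = 0.
Proof.
have := inBD 0 0; rewrite addr0 => /eqP.
by rewrite -subr_eq0 opprD addrA subrr sub0r oppr_eq0 => /eqP.
Qed.

Lemma inAB a b : inA a * inB b = tclass [:: (a, b)].
Proof. by rewrite -[LHS]/(tensor_mul _ _) tensor_mulE /seq_mul /= mul1r mulr1. Qed.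

Lemma comm_inAB a b : GRing.comm (inA a) (inB b).
Proof.
rewrite /GRing.comm inAB -[RHS]/(tensor_mul _ _) tensor_mulE /seq_mul /=.
by rewrite mul1r mulr1.
Qed.

Lemma comm_inA a a' : GRing.comm (inA a) (inA a').
Proof. by rewrite /GRing.comm -!inAM mulrC. Qed.

Lemma comm_inB b b' : GRing.comm (inB b) (inB b').
Proof. by rewrite /GRing.comm -!inBM mulrC. Qed.

Definition piA (p : {mpoly 'F_2[r.+1]}) : A := \pi_(RV_algebra r) p.
Definition piB (p : {mpoly 'F_2[m]}) : B := \pi_(W_algebra m) p.

Definition gen_RV (i : 'I_r.+1) : T := inA (piA 'X_i).
Definition gen_W (j : 'I_m) : T := inB (piB 'X_j).
Definition target_gens : seq T :=
  [seq gen_RV i | i <- enum 'I_r.+1] ++ [seq gen_W j | j <- enum 'I_m].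

Lemma piA_eq0 p : p \in RV_relations r -> piA p = 0.
Proof.
move=> /mem_ideal_span p_I; apply/eqP.
rewrite -[0](rmorph0 (\pi_(RV_algebra r))) -[_ == _]Quotient.idealrBE subr0.
exact: p_I.
Qed.

Lemma piB_eq0 p : p \in W_relations m -> piB p = 0.
Proof.
move=> /mem_ideal_span p_I; apply/eqP.
rewrite -[0](rmorph0 (\pi_(W_algebra m))) -[_ == _]Quotient.idealrBE subr0.
exact: p_I.
Qed.

Lemma gen_R_sq : gen_RV ord0 * gen_RV ord0 = 0.
Proof.
rewrite -inAM -[_ * _](rmorphM (\pi_(RV_algebra r))) -expr2.
by rewrite [X in inA X]piA_eq0 ?inA0 // mem_head.
Qed.

Lemma gen_V_sq i :
  gen_RV (lift ord0 i) * gen_RV (lift ord0 i) = gen_RV ord0 * gen_RV (lift ord0 i).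
Proof.
rewrite -!inAM; congr inA; rewrite -!(rmorphM (\pi_(RV_algebra r))).
apply/eqP; rewrite -subr_eq0 -rmorphB opp_lmodF2 -expr2; apply/eqP.
by apply: piA_eq0; rewrite inE; apply/orP; right; apply/imageP; exists i.
Qed.

Lemma gen_W_sq j : gen_W j * gen_W j = 0.
Proof.
rewrite -inBM -[_ * _](rmorphM (\pi_(W_algebra m))) -expr2.
rewrite [X in inB X]piB_eq0 ?inB0 //.
by apply/imageP; exists j.
Qed.

Lemma target_gens_cons : target_gens = gen_RV ord0 ::
  [seq gen_RV (lift ord0 i) | i <- enum 'I_r] ++ [seq gen_W j | j <- enum 'I_m].
Proof. by rewrite /target_gens enum_ordSl /= -map_comp. Qed.

Lemma in_span_gens_mul t y : t \in target_gens ->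
  in_span target_gens y -> in_span target_gens (t * y).
Proof.
rewrite target_gens_cons; apply: in_span_mul.
- exact: target_two0.
- have form u : u \in gen_RV ord0 :: [seq gen_RV (lift ord0 i) | i <- enum 'I_r] ++
      [seq gen_W j | j <- enum 'I_m] -> (exists a, u = inA a) \/ (exists b, u = inB b).
    rewrite inE mem_cat => /or3P[/eqP->|/mapP[i _ ->]|/mapP[j _ ->]].
    + by left; eexists.
    + by left; eexists.
    by right; eexists.
  move=> u v /form[[a ->]|[a ->]] /form[[b ->]|[b ->]].
  + exact: comm_inA.
  + exact: comm_inAB.
  + exact/commr_sym/comm_inAB.
  exact: comm_inB.
- exact: gen_R_sq.
move=> u; rewrite mem_cat => /orP[/mapP[i _ ->]|/mapP[j _ ->]].
  by right; exact: gen_V_sq.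
by left; exact: gen_W_sq.
Qed.

Lemma target_spanned y : in_span target_gens y.
Proof.
(* The elements whose left multiplication preserves the span are closed under sums and products and
   contain the generators, hence are all of the target; then apply this to 1. *)
pose K y := forall z, in_span target_gens z -> in_span target_gens (y * z).
suff Ky : K y by rewrite -[y]mulr1; apply: Ky; apply: in_span1.
have K0 : K 0 by move=> z _; rewrite mul0r; apply: in_span0.
have K1 : K 1 by move=> z; rewrite mul1r.
have KD a b : K a -> K b -> K (a + b).
  by move=> Ka Kb z sz; rewrite mulrDl; apply: in_spanD; [exact: target_two0|exact: Ka|exact: Kb].
have KM a b : K a -> K b -> K (a * b).
  by move=> Ka Kb z sz; rewrite -mulrA; apply/Ka/Kb.
have KA p : K (inA (piA p)).
  elim/mpolyF2_ind: p => [||p q Kp Kq|p q Kp Kq|i].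
  - by rewrite [piA 0]rmorph0 inA0.
  - by rewrite [piA 1]rmorph1.
  - by rewrite [piA _]rmorphD inAD; apply: KD.
  - by rewrite [piA _]rmorphM inAM; apply: KM.
  by move=> z; apply: in_span_gens_mul; rewrite mem_cat -[inA _]/(gen_RV i) map_f ?mem_enum.
have KB p : K (inB (piB p)).
  elim/mpolyF2_ind: p => [||p q Kp Kq|p q Kp Kq|i].
  - by rewrite [piB 0]rmorph0 inB0.
  - by rewrite [piB 1]rmorph1.
  - by rewrite [piB _]rmorphD inBD; apply: KD.
  - by rewrite [piB _]rmorphM inBM; apply: KM.
  by move=> z; apply: in_span_gens_mul; rewrite mem_cat -[inB _]/(gen_W i) orbC map_f ?mem_enum.
have [s ->] := tclassP y; elim: s => [|[a b] s IHs]; first exact: K0.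
rewrite -[_ :: s]cat1s -tensor_addE; apply: KD IHs; rewrite -inAB; apply: KM.
  by rewrite -[a]reprK; apply: KA.
by rewrite -[b]reprK; apply: KB.
Qed.

Lemma target_deg0 d : target_deg d (0 : T).
Proof. by exists [::]. Qed.

Lemma piA_deg p d : p \is d.-homog -> @RV_deg r d (piA p).
Proof. by exists p. Qed.

Lemma piB_deg p d : p \is d.-homog -> @W_deg m d (piB p).
Proof. by exists p. Qed.

Lemma RV_deg1 : @RV_deg r 0 1.
Proof. by exists 1; [exact: dhomog1 | rewrite rmorph1]. Qed.

Lemma W_deg1 : @W_deg m 0 1.
Proof. by exists 1; [exact: dhomog1 | rewrite rmorph1]. Qed.

Lemma target_deg1 : target_deg 0 (1 : T).
Proof.
exists [:: (1, 1)] => // p; rewrite inE => /eqP->; exists 0%N, 0%N.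
by split=> //; [exact: RV_deg1 | exact: W_deg1].
Qed.

Lemma target_degD d (y z : T) : target_deg d y -> target_deg d z -> target_deg d (y + z).
Proof.
move=> [s -> sd] [t -> td]; exists (s ++ t).
  by rewrite -tensor_addE.
by move=> p; rewrite mem_cat => /orP[/sd|/td].
Qed.

Lemma target_degM d e (y z : T) :
  target_deg d y -> target_deg e z -> target_deg (d + e) (y * z).
Proof.
move=> [s -> sd] [t -> te]; exists (seq_mul s t).
  by rewrite -tensor_mulE.
move=> _ /allpairsP[[p q] /= [/sd[i [j [ij [p1 p1h p1E] [p2 p2h p2E]]]]
  /te[k [l [kl [q1 q1h q1E] [q2 q2h q2E]]]] ->]].
exists (i + k)%N, (j + l)%N; split; first by rewrite addnACA ij kl.
  by exists (p1 * q1); [exact: dhomogM | rewrite p1E q1E rmorphM].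
by exists (p2 * q2); [exact: dhomogM | rewrite p2E q2E rmorphM].
Qed.

Lemma target_gens_deg : {in target_gens, forall t, target_deg 1 t}.
Proof.
move=> t; rewrite mem_cat => /orP[/mapP[i _ ->]|/mapP[j _ ->]].
  exists [:: (piA 'X_i, 1)] => // p; rewrite inE => /eqP->; exists 1%N, 0%N.
  by split=> //; [apply/piA_deg; rewrite dhomogX; apply/eqP/mdeg1 | exact: W_deg1].
exists [:: (1, piB 'X_j)] => // p; rewrite inE => /eqP->; exists 0%N, 1%N.
by split=> //; [exact: RV_deg1 | apply/piB_deg; rewrite dhomogX; apply/eqP/mdeg1].
Qed.

(** * A criterion for a graded isomorphism with the target *)

Section Isomorphism.
Variables (Q : comNzRingType) (deg : nat -> Q -> Prop).
Variables (h : 'I_r.+1 -> Q) (k : 'I_m -> Q).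
Let xs := [seq h i | i <- enum 'I_r.+1] ++ [seq k j | j <- enum 'I_m].
Hypothesis two0 : 1 + 1 = 0 :> Q.
Hypothesis deg0 : forall d, deg d 0.
Hypothesis deg1 : deg 0 1.
Hypothesis degD : forall d y z, deg d y -> deg d z -> deg d (y + z).
Hypothesis degM : forall d e y z, deg d y -> deg e z -> deg (d + e) (y * z).
Hypothesis h_deg : forall i, deg 1 (h i).
Hypothesis k_deg : forall j, deg 1 (k j).
Hypothesis h0_sq : h ord0 ^+ 2 = 0.
Hypothesis h_sq : forall i,
  h (lift ord0 i) ^+ 2 + h ord0 * h (lift ord0 i) = 0.
Hypothesis k_sq : forall j, k j ^+ 2 = 0.
Hypothesis spanned : forall X, in_span xs X.
Hypothesis free : forall c, comb xs c = 0 -> forall a, size a = size xs -> c a = false.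
Hypothesis deg_free : forall d c, deg d (comb xs c) ->
  forall a, size a = size xs -> count id a != d -> c a = false.

Lemma deg_mpoly n (l : 'I_n -> Q) (f : {rmorphism {mpoly 'F_2[n]} -> Q}) p d :
  (forall i, f 'X_i = l i) -> (forall i, deg 1 (l i)) ->
  p \is d.-homog -> deg d (f p).
Proof.
move=> fl l_deg /dhomogP pd; rewrite [p]mpolyE rmorph_sum big_seq.
apply: (big_ind (deg d)) => [|y z|a /pd ad]; [exact: deg0 | exact: degD |].
have [->|->] := F2P p@_a; first by rewrite scale0r rmorph0.
have -> : d = (\sum_i a i)%N by rewrite -ad; exact: mdegE.
rewrite scale1r mpolyXE_id rmorph_prod /=.
apply: (big_ind2 deg) => [//|d1 y1 d2 y2|i _]; first exact: degM.
rewrite rmorphXn fl; elim: (a i) => [|e IHe]; first by rewrite expr0.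
by rewrite exprS -add1n; apply: degM.
Qed.

(** The relations in [Q] yield a morphism [psi] from the target that takes spanning products to a
    basis. It is therefore bijective, and [phi] is its inverse. *)
Lemma target_isomorphism : exists phi : {rmorphism Q -> target r m},
  bijective phi /\ forall d X, deg d X <-> target_deg d (phi X).
Proof.
have [f fX] := mpoly_eval two0 h; have [g gX] := mpoly_eval two0 k.
have fI p : p \in @RV_ideal r -> f p = 0.
  apply: ideal_span_ker => a; rewrite inE => /orP[/eqP->|/imageP[i _ ->]].
    by rewrite rmorphXn /= fX.
  by rewrite rmorphD rmorphXn rmorphM /= !fX.
have gI p : p \in @W_ideal m -> g p = 0.
  by apply: ideal_span_ker => a /imageP[j _ ->]; rewrite rmorphXn /= gX.
have [f' f'E] : exists f' : {rmorphism A -> Q}, forall p, f' (piA p) = f p.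
  exact: quot_lift fI.
have [g' g'E] : exists g' : {rmorphism B -> Q}, forall p, g' (piB p) = g p.
  exact: quot_lift gI.
have [psi psiE] := @tensor_lift Q A B f' g'.
have psi_gens : [seq psi t | t <- target_gens] = xs.
  rewrite map_cat -[in X in X ++ _]map_comp -[in X in _ ++ X]map_comp.
  congr (_ ++ _); apply: eq_map => i /=.
    by rewrite psiE big_seq1 /= f'E fX rmorph1 mulr1.
  by rewrite psiE big_seq1 /= g'E gX rmorph1 mul1r.
have psi_comb c : psi (comb target_gens c) = comb xs c by rewrite combM psi_gens.
have psi_inj : injective psi.
  suff psi0 y : psi y = 0 -> y = 0 by apply: raddf_inj.
  have [c ->] := target_spanned y.
  rewrite psi_comb => /free c0; apply: comb_eq0 => a sa; apply: c0.
  by rewrite sa -psi_gens size_map.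
have psi_surj X : exists y, psi y = X.
  by have [c ->] := spanned X; exists (comb target_gens c).
pose phi X := projT1 (cid (psi_surj X)).
have phiK : cancel phi psi by move=> X; rewrite /phi; case: cid.
have psiK : cancel psi phi by move=> y; apply: psi_inj; rewrite phiK.
pose phiD := GRing.isZmodMorphism.Build _ _ phi (can2_zmod_morphism psiK phiK).
pose phiM := GRing.isMonoidMorphism.Build _ _ phi (can2_monoid_morphism psiK phiK).
pose phi' : {rmorphism Q -> target r m} := HB.pack phi phiD phiM.
exists phi'; split=> [|d X]; first by exists psi.
(* Forwards, [deg_free] leaves only products of degree [d] in the expansion. Backwards, [psi]
   preserves degrees on each pure tensor of homogeneous polynomials. *)
rewrite -[phi' X]/(phi X); split=> [|].
  have [c] := target_spanned (phi X) => phiX; rewrite phiX.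
  rewrite -[X]phiK phiX psi_comb => /deg_free c0.
  apply: deg_comb target_gens_deg _ => *; first exact: target_deg0.
  - exact: target_deg1.
  - exact: target_degD.
  - exact: target_degM.
  by apply: c0 => //; rewrite -psi_gens size_map.
rewrite -{2}[X]phiK => -[s -> sd]; rewrite psiE big_seq.
apply: (big_ind (deg d)) => [|y z|p ps]; [exact: deg0 | exact: degD |].
have [i [j [<- [p1 p1h ->] [p2 p2h ->]]]] := sd p ps.
by apply: degM; rewrite ?f'E ?g'E; [apply: deg_mpoly fX _ p1h | apply: deg_mpoly gX _ p2h].
Qed.

End Isomorphism.
End Target.

(** * The cohomology ring of a complete oriented RAAG *)

(** The binomial coefficient of [z] over 2, a quadratic refinement of the product by [triD]; the
    division is exact by [triE]. *)
Definition tri (z : int) : int := (z * (z - 1) %/ 2)%Z.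

Lemma triE z : tri z * 2 = z * (z - 1).
Proof.
apply: divzK; apply/dvdzP; elim/zpow_ind: z => [|z [k Ek]|z [k Ek]].
- by exists 0; rewrite !mul0r.
- by exists (k + z); rewrite [RHS]mulrDl -Ek; ring.
by exists (k - (z - 1)); rewrite [RHS]mulrBl -Ek; ring.
Qed.

Lemma triD a b : tri (a + b) = tri a + tri b + a * b.
Proof.
by apply: (@mulIf _ 2) => //; rewrite !mulrDl !triE; ring.
Qed.

Lemma triN b : tri (- b) = tri b + b.
Proof. by apply: (@mulIf _ 2) => //; rewrite !mulrDl !triE; ring. Qed.

Lemma F2_oddz (z : int) : z%:~R = (oddz z)%:R :> 'F_2.
Proof. by rewrite /oddz; case: (F2P z%:~R) => ->. Qed.

(** The correction term is the source of the product with [x w] in the relation of an inverted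
    vertex. *)
Lemma tri_sign (e : bool) b :
  (tri ((-1) ^+ e * b))%:~R = (tri b)%:~R + e%:R * b%:~R :> 'F_2.
Proof.
case: e; last by rewrite mul1r mul0r addr0.
by rewrite mulN1r triN rmorphD mul1r.
Qed.

Lemma intr_sign (e : bool) : ((-1) ^+ e)%:~R = 1 :> 'F_2.
Proof. by case: e; rewrite // rmorphN oppF2. Qed.

Section RaagCohomology.
Variables (L : specialGraph) (w : vertex L).
Hypothesis complete_L : complete L.
Hypothesis special_edge_target : forall e, e \in special_edges L -> e.2 = w.
Local Notation V := (vertex L).
Local Notation G := (oriented_raag L).
Implicit Types (u v : V) (g h : G).

Definition parity v g : 'F_2 := (exponent w v g)%:~R.

Lemma parityM v g h : parity v (g * h)%g = parity v g + parity v h.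
Proof. by rewrite /parity exponentM // rmorphD rmorphM /= intr_sign mul1r. Qed.

Definition parity_cocycle v : cocycle G := Cocycle (hom_cocycleP (parityM v)).

Lemma parity_degree1 v : degree1 (parity_cocycle v).
Proof. by case=> [|g []]. Qed.

Lemma act_parity y g v :
  (act w y g v)%:~R = (y v)%:~R + parity_cocycle v [:: g] :> 'F_2.
Proof. by rewrite actE // rmorphD rmorphM /= intr_sign mul1r. Qed.

Definition parity_class v : cohomology G := coclass (parity_cocycle v).

Lemma parity_class_deg v : cohomology_deg 1 (parity_class v).
Proof. by exists (parity_cocycle v); first exact: parity_degree1. Qed.

Lemma parity_class_comm u v : GRing.comm (parity_class u) (parity_class v).
Proof.
rewrite /GRing.comm -!rmorphM; apply/coclass_eqP.
exists (deg1_cochain (fun g => parity u g * parity v g)) => t.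
rewrite [RHS]cobound_deg1 !deg1M; try exact: parity_degree1.
case: t => [|g [|h []]]; rewrite ?addr0 //= => *; rewrite ?addr0 //.
rewrite !parityM; set a := parity u g; set b := parity v g.
set c := parity u h; set d := parity v h.
transitivity ((a * b + a * b) + (c * d + c * d) + (a * d + b * c)); last by ring.
by rewrite !addF2 !add0r.
Qed.

Lemma parity_class_sq v : parity_class v ^+ 2 +
  (if inverted w v then parity_class w * parity_class v else 0) = 0.
Proof.
pose Z : cocycle G :=
  if inverted w v then parity_cocycle w * parity_cocycle v else 0.
have ZE t : Z t = (inverted w v)%:R * (parity_cocycle w * parity_cocycle v) t.
  by rewrite /Z; case: ifP; rewrite ?mul1r ?mul0r.
rewrite (_ : (if _ then _ else _) = coclass Z); last first.
  by rewrite /Z; case: ifP; rewrite ?rmorphM ?rmorph0.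
rewrite expr2 -rmorphM -rmorphD -[RHS](rmorph0 (@coclass G)); apply/coclass_eqP.
exists (deg1_cochain (fun g => (tri (exponent w v g))%:~R)) => t.
rewrite [RHS]cobound_deg1 addr0 cocycleD ZE !deg1M; try exact: parity_degree1.
case: t => [|g [|h [|? ?]]]; rewrite ?mulr0 ?addr0 //=.
(* At the product of [g] and [h], [triD] contributes the cup square and [tri_sign] the product with
   the class of [w]; the values of [tri] at [g] and at [h] cancel. *)
rewrite exponentM // triD !rmorphD !rmorphM /= tri_sign intr_sign mul1r.
rewrite /parity [in X in _ + X]F2_oddz.
set e := inverted w v; set o := oddz _.
have -> : (e && o)%:R = e%:R * o%:R :> 'F_2 by case: e; case: o; rewrite ?mulr1 ?mulr0.
set a := (exponent w v g)%:~R; set b := (exponent w v h)%:~R.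
set ta := (tri _)%:~R; set tb := (tri _)%:~R.
transitivity ((ta + ta) + (tb + tb) + (a * b + e%:R * (o%:R * b))); last by ring.
by rewrite !addF2 !add0r.
Qed.

Variable s : seq V.
Hypothesis uniq_ws : uniq (w :: s).
Hypothesis mem_ws : forall v, v \in w :: s.

Lemma raag_cocycle_comb (z : cocycle G) : exists c (h : seq G -> 'F_2),
  forall t, z t = comb (map parity_cocycle (w :: s)) c t + cobound h t.
Proof.
apply: (@cocycle_comb _ _ (act w) parity_cocycle _ _ _ (@origin L) (normal_form w s) w).
- exact: actM.
- exact: parity_degree1.
- exact: act_parity.
- exact: normal_form_act.
- exact: act_normal_form.
- exact: act_agree.
- exact: act_shift.
- exact: act_shift_w.
- exact: uniq_ws.
exact: mem_ws.
Qed.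

Lemma raag_comb_cobound c (h : seq G -> 'F_2) :
  (forall t, comb (map parity_cocycle (w :: s)) c t = cobound h t) ->
  forall m, size m = size (w :: s) -> c m = false.
Proof.
apply: (@comb_cobound _ _ (act w) parity_cocycle _ _ _ (@origin L) (normal_form w s) w).
- exact: actM.
- exact: parity_degree1.
- exact: act_parity.
- exact: normal_form_act.
- exact: act_normal_form.
- exact: act_agree.
- exact: act_shift.
- exact: act_shift_w.
- exact: uniq_ws.
exact: mem_ws.
Qed.

(** The ring is generated by the classes of degree 1, which commute pairwise. This supplies the
    commutative structure assumed by [target_isomorphism]. *)
Lemma raag_cohomology_mulC : commutative (@GRing.mul (cohomology G)).
Proof.
have span := cohomology_spanned parity_degree1 raag_cocycle_comb.
have comm v X : GRing.comm (parity_class v) X.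
  have [c ->] := span X; apply: comm_comb => _ /mapP[u _ ->].
  exact: parity_class_comm.
move=> X X'; have [c ->] := span X'; apply: comm_comb => _ /mapP[v _ ->].
exact/commr_sym/comm.
Qed.

End RaagCohomology.

(** By completeness all the vertices form a clique, which has at most one special vertex; without
    special edges any vertex serves as [w]. *)
Lemma special_edges_target (L : specialGraph) : complete L ->
  exists w : vertex L, forall e, e \in special_edges L -> e.2 = w.
Proof.
move=> complete_L; have [E0|[e0 e0s]] := set_0Vmem (special_edges L).
  have /card_gt0P[w _] := vertex_nonempty L.
  by exists w => e; rewrite E0 inE.
have target e : e \in special_edges L ->
    e.2 \in [set: vertex L] :&: special_vertices L.
  by case: e => o t es; rewrite !inE; apply/special_vertexP; exists o.
exists e0.2 => e es; have clT : clique [set: vertex L].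
  by move=> u v _ _; apply: complete_L.
have /cards1P[v vE] : #|[set: vertex L] :&: special_vertices L| == 1.
  rewrite eqn_leq clique_special //; apply/card_gt0P; exists e0.2; exact: target.
have := target _ es; have := target _ e0s.
by rewrite vE !inE => /eqP -> /eqP ->.
Qed.

Lemma map_nth_enum (T T' : Type) (f : T -> T') (a : T) (t : seq T) k :
  size t = k -> [seq f (nth a t (i : 'I_k)) | i <- enum 'I_k] = map f t.
Proof.
move=> <-; apply: (@eq_from_nth _ (f a)); rewrite size_map.
  by rewrite size_enum_ord size_map.
rewrite size_enum_ord => i lt_i; rewrite (nth_map (Ordinal lt_i)) ?size_enum_ord //.
by rewrite nth_enum_ord // (nth_map a).
Qed.

Theorem mainTheorem2 (L : specialGraph) (n r : nat)
    (hcomplete : complete L)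
    (hV : #|vertex L| = n.+1)
    (hEs : #|special_edges L| = r) :
  exists phi : {rmorphism cohomology (oriented_raag L) -> target r (n - r)},
    bijective phi /\
    forall (d : nat) (x : cohomology (oriented_raag L)),
      cohomology_deg d x <-> target_deg d (phi x).
Proof.
have [w wP] := special_edges_target hcomplete.
(* The vertex [w] will give the variable R, those in [A] the V's and those in [B] the W's. Special
   edges correspond to their origins, all having target [w], whence the size of [A]. *)
pose A := enum [pred v | inverted w v].
pose B := enum [pred v | (v != w) && ~~ inverted w v].
have sA : size A = r.
  rewrite -cardE -hEs -(card_imset _ (_ : injective (fun v => (v, w)))); last first.
    by move=> u v [].
  apply: eq_card => -[u v]; apply/imsetP/idP => [[u' iu' [-> ->]]|es]; first exact: iu'.
  have vw := wP _ es; rewrite /= in vw; rewrite vw in es *.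
  by exists u.
have uniq_ws : uniq (w :: A ++ B).
  rewrite cons_uniq mem_cat !mem_enum !inE inverted_w eqxx /= cat_uniq !enum_uniq andbT.
  by apply/hasPn => v; rewrite !mem_enum !inE => /andP[].
have mem_ws v : v \in w :: A ++ B.
  by rewrite inE mem_cat !mem_enum !inE; case: eqVneq => //=; case: inverted.
have sAB : size (A ++ B) = n.
  apply: succn_inj; rewrite -hV -[(size _).+1]/(size (w :: A ++ B)).
  by rewrite -(card_uniqP uniq_ws); apply: eq_card => v; rewrite mem_ws.
(* The subtraction is not truncated, since [A ++ B] has size [n] and [A] has size [r]. *)
have sB : size B = (n - r)%N by rewrite -sAB size_cat sA addKn.
pose x := parity_class wP.
have deg1_x := parity_degree1 wP.
pose comm_mixin := GRing.PzSemiRing_hasCommutativeMul.Build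
  (cohomology (oriented_raag L)) (raag_cohomology_mulC hcomplete wP uniq_ws mem_ws).
pose nz_mixin := GRing.PzSemiRing_isNonZero.Build
  (cohomology (oriented_raag L)) (@cohomology_oner_neq0 _).
pose Q : comNzRingType := HB.pack (cohomology (oriented_raag L)) comm_mixin nz_mixin.
have xsE : [seq x (nth w (w :: A) (i : 'I_r.+1)) | i <- enum 'I_r.+1] ++
    [seq x (nth w B (j : 'I_(n - r))) | j <- enum 'I_(n - r)] = map x (w :: A ++ B).
  by rewrite (@map_nth_enum _ _ x w (w :: A)) /= ?sA // (@map_nth_enum _ _ x w B) // map_cat.
apply: (@target_isomorphism r (n - r) Q (@cohomology_deg (oriented_raag L))
  (fun i => x (nth w (w :: A) i)) (fun j => x (nth w B j))).
- exact: cohomology_two0.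
- exact: cohomology_deg0.
- exact: cohomology_deg1.
- exact: cohomology_degD.
- exact: cohomology_degM.
- by move=> i; apply: parity_class_deg.
- by move=> j; apply: parity_class_deg.
- have := parity_class_sq wP w.
  by rewrite inverted_w addr0.
- move=> i; have := parity_class_sq wP (nth w A i).
  have : nth w A i \in A by rewrite mem_nth ?sA.
  by rewrite mem_enum inE => ->.
- move=> j; have := parity_class_sq wP (nth w B j).
  have : nth w B j \in B by rewrite mem_nth ?sB.
  by rewrite mem_enum inE => /andP[_ /negbTE ->]; rewrite addr0.
- move=> X; rewrite /in_span xsE.
  exact: (cohomology_spanned deg1_x (raag_cocycle_comb hcomplete wP uniq_ws mem_ws)).
- move=> c; rewrite xsE size_map.
  exact: (cohomology_free (raag_comb_cobound hcomplete uniq_ws mem_ws)).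
move=> d c; rewrite xsE size_map; apply: (cohomology_deg_comb deg1_x).
  exact: raag_cocycle_comb.
exact: raag_comb_cobound.
Qed.
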